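(* Fix a stage $k$, the past data $\mathbf Y_{1:k-1}$, and a transmit beamforming matrix $\mathbf V_k=[\mathbf v_{k,1},\dots,\mathbf v_{k,M_T}]\in\mathbb C^{N_T\times M_T}$ with $\mathrm{tr}(\mathbf V_k\mathbf V_k^{\mathsf H})\le P$, and put $\mathbf R_{\mathbf V_k}=\mathbf V_k\mathbf V_k^{\mathsf H}$. Consider the problem $$\text{(A)}\quad \min_{\mathbf R_{\mathbf W}\in\mathbb C^{N_R\times N_R},\ d_1,\dots,d_{3L}\in\mathbb R}\ \sum_{\ell=1}^{3L}d_\ell\quad\text{s.t.}\quad \begin{bmatrix}\mathbf J_k(\mathbf R_{\mathbf V_k},\mathbf R_{\mathbf W})&\sqrt{q_\ell}\,\mathbf e_\ell\\ \sqrt{q_\ell}\,\mathbf e_\ell^{\mathsf T}&d_\ell\end{bmatrix}\succeq 0\ \ \forall \ell,$$ $$\mathbf R_{\mathbf W}\text{ is an orthogonal projection matrix},\quad \mathrm{rank}(\mathbf R_{\mathbf W})=M_R,\quad \mathbf R_{\mathbf W}\succeq 0 .$$ Let $\mathbf\Lambda^*$ be a maximizer of $$\max_{\mathbf\Lambda\in\mathbb R^{3L\times 3L}}\ 2\,\mathrm{tr}(\mathbf\Lambda\mathbf Q^{1/2})-\mathrm{tr}\big(\mathbf\Lambda^{\mathsf T}\mathbf J_{k-1}^{(\mathsf P)}\mathbf\Lambda\big)-2\sum_{i=1}^{M_R}\mu_i\big(\mathbf P_{\mathbf\Lambda\mathbf\Lambda^{\mathsf T}}\big),$$ where $\mathbf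 P_{\mathbf\Lambda\mathbf\Lambda^{\mathsf T}}=\sum_{m=1}^{M_T}\mathbb E\big[\dot{\mathbf G}_{k,m}(\boldsymbol\theta)\mathbf\Lambda\mathbf\Lambda^{\mathsf T}\dot{\mathbf G}_{k,m}^{\mathsf H}(\boldsymbol\theta)\,\big|\,\mathbf Y_{1:k-1}\big]$ and $\dot{\mathbf G}_{k,m}(\boldsymbol\theta)=\big[\dot{\mathbf H}_1(\boldsymbol\theta)\mathbf v_{k,m}\ \cdots\ \dot{\mathbf H}_{3L}(\boldsymbol\theta)\mathbf v_{k,m}\big]$. If $\mu_{M_R}(\mathbf P_{\mathbf\Lambda^*(\mathbf\Lambda^* )^{\mathsf T}})>\mu_{M_R+1}(\mathbf P_{\mathbf\Lambda^*(\mathbf\Lambda^* )^{\mathsf T}})$, then the semidefinite relaxation of (A), $$\min_{\mathbf R_{\mathbf W},\ d_1,\dots,d_{3L}}\ \sum_{\ell=1}^{3L}d_\ell\quad\text{s.t.}\quad \begin{bmatrix}\mathbf J_k(\mathbf R_{\mathbf V_k},\mathbf R_{\mathbf W})&\sqrt{q_\ell}\,\mathbf e_\ell\\ \sqrt{q_\ell}\,\mathbf e_\ell^{\mathsf T}&d_\ell\end{bmatrix}\succeq 0\ \ \forall \ell,\quad \mathbf 0\preceq\mathbf R_{\mathbf W}\preceq\mathbf I_{N_R},\quad \mathrm{tr}(\mathbf R_{\mathbf W})=M_R,$$ is tight, i.e., it has the same optimal value as (A).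
   Context: Notation: $\mu_i(\cdot)$ is the $i$-th largest eigenvalue (with multiplicity) of a Hermitian matrix; $\mathbf e_\ell$ is the $\ell$-th column of $\mathbf I_{3L}$; $\succeq$ is the positive semidefinite (PSD) order; $\imath=\sqrt{-1}$. Model: integers $L\ge1$, $1\le M_T<N_T$, $1\le M_R<N_R$; power $P>0$; weights $q_1,\dots,q_{3L}\ge 0$ with $\sum_\ell q_\ell=1$, $\mathbf Q=\mathrm{diag}(q_1,\dots,q_{3L})$. The random parameter is $\boldsymbol\theta=[\boldsymbol\phi^{\mathsf T},\mathrm{Re}\,\boldsymbol\alpha^{\mathsf T},\mathrm{Im}\,\boldsymbol\alpha^{\mathsf T}]^{\mathsf T}\in\mathbb R^{3L}$ with prior density $f(\boldsymbol\theta)$: $\phi_i$ is uniform on $[\phi_{\min},\phi_{\max}]$, and $\alpha_i\sim\mathcal{CN}(0,1)$ are i.i.d. and independent of $\boldsymbol\phi$. The response matrix is $\mathbf H(\boldsymbol\theta)=\sum_{i=1}^L\alpha_i\mathbf a_{\rm R}(\phi_i)\mathbf a_{\rm T}^{\mathsf H}(\phi_i)\in\mathbb C^{N_R\times N_T}$, $\mathbf a_{\rm S}(\phi)=[1,e^{\imath\pi\sin\phi},\dots,e^{\imath(N_{\rm S}-1)\pi\sin\phi}]^{\mathsf T}$ for ${\rm S}\in\{{\rm R},{\rm T}\}$, and $\dot{\mathbf H}_i(\boldsymbol\theta)=\partial\mathbf H(\boldsymbol\theta)/\partial\theta_i$. Past measurements are $\mathbf Y_\ell=\mathbf W_\ell^{\mathsf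 H}\mathbf H(\boldsymbol\theta)\mathbf V_\ell+\mathbf W_\ell^{\mathsf H}\mathbf Z_\ell$, $\ell=1,\dots,k-1$, where $\mathbf V_\ell\in\mathbb C^{N_T\times M_T}$, $\mathbf W_\ell\in\mathbb C^{N_R\times M_R}$ (full column rank) are known functions of the earlier measurements and $\mathbf Z_\ell$ has i.i.d. $\mathcal{CN}(0,1)$ entries, independent of everything else. $\mathbb E[\cdot\mid\mathbf Y_{1:k-1}]$ is expectation under the posterior of $\boldsymbol\theta$ given $\mathbf Y_{1:k-1}=(\mathbf Y_1,\dots,\mathbf Y_{k-1})$. Bayesian Fisher information matrix (BFIM): for Hermitian $\mathbf R_{\mathbf V}\in\mathbb C^{N_T\times N_T}$, $\mathbf R_{\mathbf W}\in\mathbb C^{N_R\times N_R}$, $\mathbf J_k(\mathbf R_{\mathbf V},\mathbf R_{\mathbf W})=\mathbf J_k^{(\mathsf D)}(\mathbf R_{\mathbf V},\mathbf R_{\mathbf W})+\mathbf J_{k-1}^{(\mathsf P)}\in\mathbb R^{3L\times3L}$, where $$[\mathbf J_k^{(\mathsf D)}(\mathbf R_{\mathbf V},\mathbf R_{\mathbf W})]_{i,j}=2\,\mathrm{Re}\,\mathrm{tr}\,\mathbb E\big[\mathbf R_{\mathbf W}\dot{\mathbf H}_i(\boldsymbol\theta)\mathbf R_{\mathbf V}\dot{\mathbf H}_j^{\mathsf H}(\boldsymbol\theta)\mid\mathbf Y_{1:k-1}\big],\qquad [\mathbf J_{k-1}^{(\mathsf P)}]_{i,j}=-\mathbb E\Big[\tfrac{\partial^2\log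 f(\boldsymbol\theta\mid\mathbf Y_{1:k-1})}{\partial\theta_i\partial\theta_j}\Big|\mathbf Y_{1:k-1}\Big].$$ $\mathbf J_{k-1}^{(\mathsf P)}$ is a fixed real symmetric matrix, assumed PSD. Standing identifiability assumption: with $\mathbf R_{\mathbf V_k}$ fixed, $\mathbf J_k(\mathbf R_{\mathbf V_k},\mathbf R_{\mathbf W})$ is invertible for some feasible $\mathbf R_{\mathbf W}$. *)

(* Defs.v *)
From HB Require Import structures.
From mathcomp Require Import all_boot all_order all_algebra.
From mathcomp Require Import complex.
From mathcomp Require Import all_classical all_reals all_analysis.

Set Implicit Arguments.
Unset Strict Implicit.
Unset Printing Implicit Defensive.

Import Order.TTheory GRing.Theory Num.Theory.
Import numFieldNormedType.Exports.

Local Open Scope classical_set_scope.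
Local Open Scope ring_scope.
Local Open Scope complex_scope.
Local Open Scope sesquilinear_scope.

(* The library has no n-fold Lebesgue measure; it is built here on n-tuples by
   iterating the binary product measure along (x, t) |-> x :: t.  The general
   sigma-finiteness instance of [m1 \x m2] is not exported by the library,
   hence the direct proof below. *)
Section LebesgueStep.
Context {R : realType} {n : nat}.
Variable mu : {sigma_finite_measure set (n.-tuple (measurableTypeR R)) -> \bar R}.

Definition consp (p : measurableTypeR R * n.-tuple (measurableTypeR R)) :
  n.+1.-tuple (measurableTypeR R) := [tuple of p.1 :: p.2].

Lemma measurable_consp : measurable_fun setT consp.
Proof. exact: measurable_cons. Qed.

Definition lebesgue_step : set (n.+1.-tuple (measurableTypeR R)) -> \bar R :=
  pushforward (@lebesgue_measure R \x mu)%E consp.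

HB.instance Definition _ := Measure.copy lebesgue_step
  (measure_function_pushforward__canonical__measure_function_Measure
     (@lebesgue_measure R \x mu)%E measurable_consp).

Lemma lebesgue_step_sigma_finite : sigma_finite setT lebesgue_step.
Proof.
have /sigma_finiteP[F [TF ndF Foo]] := sigma_finiteT (@lebesgue_measure R).
have /sigma_finiteP[G [TG ndG Goo]] := sigma_finiteT mu.
pose uncons (t : n.+1.-tuple (measurableTypeR R)) :=
  (thead t, [tuple of behead t]).
have consK : cancel consp uncons by case=> x t; congr pair; apply/val_inj.
have muncons : measurable_fun setT uncons.
  apply/measurable_fun_pair => /=; first exact: measurable_tnth.
  exact: measurable_behead.
exists (fun k => uncons @^-1` (F k `*` G k)).
  apply/seteqP; split => // t _.
  have [k _ Fk] : (\bigcup_i F i) (thead t) by rewrite -TF.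
  have [l _ Gl] : (\bigcup_i G i) [tuple of behead t] by rewrite -TG.
  exists (maxn k l) => //; split => /=.
  - by move: Fk; exact/subsetPset/ndF/leq_maxl.
  - by move: Gl; exact/subsetPset/ndG/leq_maxr.
move=> k; have [mF Fk] := Foo k; have [mG Gk] := Goo k; split.
  by rewrite -[X in measurable X]setTI; apply: muncons => //; exact: measurableX.
rewrite /lebesgue_step /pushforward -comp_preimage.
rewrite (_ : uncons \o consp = id); last by apply/funext => p; exact: consK.
by rewrite preimage_id product_measure1E// lte_mul_pinfty// ge0_fin_numE.
Qed.

HB.instance Definition _ := Measure_isSigmaFinite.Build _ _ _ lebesgue_step
  lebesgue_step_sigma_finite.
End LebesgueStep.

Fixpoint lebesgue_tuple (R : realType) (n : nat) :
  {sigma_finite_measure set (n.-tuple (measurableTypeR R)) -> \bar R} :=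
  match n with
  | 0 => \d_([tuple] : 0.-tuple (measurableTypeR R))
  | m.+1 => lebesgue_step (lebesgue_tuple R m)
  end.

Section MatrixNotions.
Context {R : realType}.
Local Notation C := R[i].

Definition psdmxC n (A : 'M[C]_n) : Prop :=
  A^t* = A /\ forall x : 'cV[C]_n, 0 <= (x^t* *m A *m x) 0 0.

Definition psdmxR n (A : 'M[R]_n) : Prop :=
  A^T = A /\ forall x : 'cV[R]_n, 0 <= (x^T *m A *m x) 0 0.

Definition orthoprojmx n (A : 'M[C]_n) : Prop := A^t* = A /\ A *m A = A.

(* Roots of the characteristic polynomial, with algebraic multiplicity. *)
Definition eigvals n (A : 'M[C]_n) : seq C :=
  sval (closed_field_poly_normal (char_poly A)).

(* The i-th largest eigenvalue, for 1 <= i <= n.  Meant for Hermitian A, whose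
   eigenvalues are real, so that taking real parts loses nothing. *)
Definition eigval n (A : 'M[C]_n) (i : nat) : R :=
  nth 0 (sort (fun x y : R => y <= x) [seq complex.Re z | z <- eigvals A]) i.-1.

Definition projection_constraint {n : nat} (r : nat) (A : 'M[C]_n) : Prop :=
  [/\ orthoprojmx A, \rank A = r & psdmxC A].

Definition relaxed_constraint {n : nat} (r : nat) (A : 'M[C]_n) : Prop :=
  [/\ psdmxC A, psdmxC (1%:M - A) & \tr A = r%:R].

Definition cexpi (x : R) : C := cos x +i* sin x.

(* Density at X of a random m x n matrix with i.i.d. CN(0, S) columns. *)
Definition cgauss_pdf m n (S : 'M[C]_m) (X : 'M[C]_(m, n)) : R :=
  (pi ^+ (m * n))^-1 * (complex.Re (\det S) ^+ n)^-1 *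
  expR (- complex.Re (\tr (X^t* *m invmx S *m X))).

End MatrixNotions.

(* The parameter theta = [phi, Re alpha, Im alpha] has dimension 3L, written
   L + (L + L) so that the three blocks are reached by lshift / rshift. *)
Notation pdim L := (L + (L + L))%N.

Section SensingModel.
Context {R : realType} {L NT NR MT MR k : nat}.
Local Notation C := R[i].
Local Notation param := 'rV[R]_(pdim L).

(* Joint prior density of the angles phi_1, ..., phi_L. *)
Variable fphi : L.-tuple (measurableTypeR R) -> R.
(* Beamformers of a stage, as functions of the list of the measurements of all
   the earlier stages. *)
Variable Vpol : seq 'M[C]_(MR, MT) -> 'M[C]_(NT, MT).
Variable Wpol : seq 'M[C]_(MR, MT) -> 'M[C]_(NR, MR).
(* Observed values of Y_1, ..., Y_(k-1). *)
Variable Y : k.-1.-tuple 'M[C]_(MR, MT).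

Definition angle (th : param) (i : 'I_L) : R := th 0 (lshift (L + L) i).
Definition gain (th : param) (i : 'I_L) : C :=
  th 0 (rshift L (lshift L i)) +i* th 0 (rshift L (rshift L i)).

Definition steering (N : nat) (phi : R) : 'cV[C]_N :=
  \col_(n < N) cexpi (n%:R * pi * sin phi).

Definition response (th : param) : 'M[C]_(NR, NT) :=
  \sum_(i < L) gain th i *:
    (steering NR (angle th i) *m (steering NT (angle th i))^t* ).

Definition basis (i : 'I_(pdim L)) : param := delta_mx 0 i.

(* Entrywise partial derivative; the derivative of a complex-valued function of
   real variables is taken on its real and imaginary parts. *)
Definition dresponse (i : 'I_(pdim L)) (th : param) : 'M[C]_(NR, NT) :=
  \matrix_(a < NR, b < NT)
    ('D_(basis i) (fun x => complex.Re (response x a b)) th +i*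
     'D_(basis i) (fun x => complex.Im (response x a b)) th).

Definition prior (th : param) : R :=
  fphi [tuple angle th i | i < L] *
  \prod_(i < L) (pi^-1 * expR (- complex.Re (gain th i * (gain th i)^* ))).

(* Given the earlier measurements and theta, the columns of
   Y_l - W_l^H H(theta) V_l = W_l^H Z_l are i.i.d. CN(0, W_l^H W_l). *)
Definition likelihood (th : param) : R :=
  \prod_(l < k.-1)
    let V := Vpol (take l Y) in let W := Wpol (take l Y) in
    cgauss_pdf (W^t* *m W) (tnth Y l - W^t* *m response th *m V).

Definition param_of_tuple (t : (pdim L).-tuple (measurableTypeR R)) : param :=
  \row_i tnth t i.

Definition posterior (th : param) : R :=
  prior th * likelihood th /
  (\int[lebesgue_tuple R (pdim L)]_t
     (prior (param_of_tuple t) * likelihood (param_of_tuple t))).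

Definition Epost (g : param -> R) : R :=
  \int[lebesgue_tuple R (pdim L)]_t
    (g (param_of_tuple t) * posterior (param_of_tuple t)).

Definition EpostM m n (G : param -> 'M[C]_(m, n)) : 'M[C]_(m, n) :=
  \matrix_(i < m, j < n)
    (Epost (fun th => complex.Re (G th i j)) +i*
     Epost (fun th => complex.Im (G th i j))).

Definition J_D (RV : 'M[C]_NT) (RW : 'M[C]_NR) : 'M[R]_(pdim L) :=
  \matrix_(i, j) (2 * complex.Re (\tr (EpostM (fun th =>
    RW *m dresponse i th *m RV *m (dresponse j th)^t* )))).

(* Where the posterior density vanishes ln is 0 by convention; this is harmless
   since Epost gives that region weight 0. *)
Definition J_P : 'M[R]_(pdim L) :=
  \matrix_(i, j) - Epost (fun th =>
    'D_(basis i) (fun y => 'D_(basis j) (fun x => ln (posterior x)) y) th).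

Definition bfim (RV : 'M[C]_NT) (RW : 'M[C]_NR) : 'M[R]_(pdim L) :=
  J_D RV RW + J_P.

Definition Gdot (v : 'cV[C]_NT) (th : param) : 'M[C]_(NR, pdim L) :=
  \matrix_(a < NR, i < pdim L) (dresponse i th *m v) a 0.

(* P_X for a real X; used at X = Lambda Lambda^T. *)
Definition Pmx (V : 'M[C]_(NT, MT)) (X : 'M[R]_(pdim L)) : 'M[C]_NR :=
  \sum_(m < MT) EpostM (fun th =>
    Gdot (col m V) th *m map_mx (real_complex R) X *m (Gdot (col m V) th)^t* ).

Definition sqrtQ (q : 'I_(pdim L) -> R) : 'M[R]_(pdim L) :=
  diag_mx (\row_l Num.sqrt (q l)).

Definition dual_objective (V : 'M[C]_(NT, MT)) (q : 'I_(pdim L) -> R)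
    (Lam : 'M[R]_(pdim L)) : R :=
  2 * \tr (Lam *m sqrtQ q) - \tr (Lam^T *m J_P *m Lam)
  - 2 * \sum_(1 <= i < MR.+1) eigval (Pmx V (Lam *m Lam^T)) i.

Definition lmi (J : 'M[R]_(pdim L)) (q d : 'I_(pdim L) -> R) : Prop :=
  forall l, let b := Num.sqrt (q l) *: col l 1%:M in
    psdmxR (block_mx J b b^T (d l)%:M).

(* Infimum of d_1 + ... + d_(3L) over the feasible pairs (R_W, d). *)
Definition optimal_value (constr : 'M[C]_NR -> Prop) (V : 'M[C]_(NT, MT))
    (q : 'I_(pdim L) -> R) : \bar R :=
  ereal_inf [set (\sum_l (rd.2 : 'I_(pdim L) -> R) l)%:E | rd in
    [set rd : 'M[C]_NR * ('I_(pdim L) -> R) |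
       constr rd.1 /\ lmi (bfim (V *m V^t* ) rd.1) q rd.2]].

End SensingModel.

(* Main.v *)
(* The matrix [J_k(R_W)] depends affinely on [R_W] through the correlations
   [K_ij = E(H_i R_V H_j^* )]: the data part has entries [2 Re tr (R_W K_ij)] and
   [P_X = sum_ij X_ij K_ij].  Let [W] project onto the [M_R] leading eigenvectors
   of [P] at the dual maximizer [Lam].  The eigenvalue gap makes the dual
   objective differentiable at [Lam], and maximality becomes
   [J(W) Lam = Q^(1/2)].  Hence [W] with [d_l = (Lam^T J(W) Lam)_ll] satisfies
   the LMIs, and its value [tr (Lam^T J(W) Lam)] equals the dual optimum.  Testing
   the LMIs of a relaxed point on the vectors [(Lam e_l, -1)] and bounding
   [Re tr (R_W P)] by Ky Fan's inequality shows that no relaxed point does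
   better.  Linearity of the expectations needs integrability: every entry of a
   derivative of the response grows at most like [exp (|alpha|^2 / 4)], up to
   constants, which the Gaussian prior of the gains absorbs. *)

Require Import Defs.
From HB Require Import structures.
From mathcomp Require Import all_boot all_order all_algebra.
From mathcomp Require Import fingroup perm complex.
From mathcomp Require Import all_classical all_reals all_analysis.
From mathcomp Require Import measurable_realfun.
From mathcomp Require Import ring lra zify.

Set Implicit Arguments.
Unset Strict Implicit.
Unset Printing Implicit Defensive.

Import Order.TTheory GRing.Theory Num.Theory.
Import numFieldNormedType.Exports.

Local Open Scope classical_set_scope.
Local Open Scope ring_scope.
Local Open Scope complex_scope.
Local Open Scope sesquilinear_scope.

(** * Hermitian matrices and Ky Fan's inequality *)

Section ConjugateTranspose.
Context {C : numClosedFieldType}.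

Lemma adjmx_mul m n p (A : 'M[C]_(m, n)) (B : 'M[C]_(n, p)) :
  (A *m B)^t* = B^t* *m A^t*.
Proof. by rewrite trmx_mul map_mxM. Qed.

Lemma adjmxB m n (A B : 'M[C]_(m, n)) : (A - B)^t* = A^t* - B^t*.
Proof. by rewrite linearB map_mxB. Qed.

Lemma adjmx1 n : (1%:M : 'M[C]_n)^t* = 1%:M.
Proof. by rewrite trmx1 map_mx1. Qed.

Lemma adjmx_pid m n r : (pid_mx r : 'M[C]_(m, n))^t* = pid_mx r.
Proof. by rewrite tr_pid_mx map_pid_mx. Qed.

(** In the rank factorization [A = col_base A *m row_base A], idempotence lets both outer factors be
    cancelled, so the factors multiplied in the other order give the identity of size [\rank A]. *)
Lemma mxtrace_idempotent n (A : 'M[C]_n) :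
  A *m A = A -> \tr A = (\rank A)%:R.
Proof.
move=> iA; rewrite -{1}(mulmx_base A) mxtrace_mulC.
suff -> : row_base A *m col_base A = 1%:M by rewrite mxtrace1.
have fB : row_free (row_base A) by exact: row_base_free.
have fC : row_full (col_base A) by exact: col_base_full.
apply: (row_full_inj fC); apply: (row_free_inj fB).
by rewrite /= mulmx1 (mulmxA (col_base A)) -mulmxA !mulmx_base iA.
Qed.

Lemma unitarymx_mulVC n (U : 'M[C]_n) : U \is unitarymx -> U^t* *m U = 1%:M.
Proof. by move=> uU; rewrite -invmx_unitary// mulVmx// unitarymx_unit. Qed.

Lemma unitarymx_mulCV n (U : 'M[C]_n) : U \is unitarymx -> U *m U^t* = 1%:M.
Proof. by move=> uU; rewrite -invmx_unitary// mulmxV// unitarymx_unit. Qed.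

Lemma unitarymx_perm n (sg : 'S_n) (U : 'M[C]_n) :
  U \is unitarymx -> perm_mx sg *m U \is unitarymx.
Proof.
move=> uU; apply: mul_unitarymx => //; apply/unitarymxP.
by rewrite tr_perm_mx map_perm_mx -perm_mxM mulgV perm_mx1.
Qed.

(** Permuting the eigenvalues is compensated by permuting the rows of the unitary matrix; this is
    what allows the spectrum to be sorted. *)
Lemma perm_mx_conj_diag n (sg : 'S_n) (U : 'M[C]_n) (D : 'rV[C]_n) :
  (perm_mx sg *m U)^t* *m diag_mx (\row_i D 0 (sg i)) *m (perm_mx sg *m U) =
  U^t* *m diag_mx D *m U.
Proof.
rewrite adjmx_mul -!mulmxA; congr (_ *m _).
rewrite !mulmxA; congr (_ *m _).
rewrite tr_perm_mx map_perm_mx -{3}[sg]invgK -col_permE -row_permE.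
by apply/matrixP => i j; rewrite !mxE (inj_eq perm_inj) permKV.
Qed.

Lemma char_poly_unitary_diag n (U : 'M[C]_n) (D : 'rV[C]_n) : U \is unitarymx ->
  char_poly (U^t* *m diag_mx D *m U) = \prod_(i < n) ('X - (D 0 i)%:P).
Proof.
move=> uU; set A := _ *m _ *m U.
rewrite -(_ : char_poly (diag_mx D) = \prod_(i < n) _); last first.
  rewrite char_poly_trig ?diag_mx_is_trig//.
  by apply: eq_bigr => i _; rewrite mxE eqxx mulr1n.
rewrite /char_poly /char_poly_mx.
have -> : 'X%:M - map_mx polyC A =
    map_mx polyC (U^t* ) *m ('X%:M - map_mx polyC (diag_mx D)) *m
    map_mx polyC U.
  rewrite mulmxBr mulmxBl -!map_mxM -/A; congr (_ - _).
  by rewrite scalar_mxC -mulmxA -map_mxM unitarymx_mulVC// map_mx1 mulmx1.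
rewrite !det_mulmx mulrC mulrA -det_mulmx -map_mxM unitarymx_mulCV//.
by rewrite map_mx1 det1 mul1r.
Qed.

Lemma unitarymx_conjK n (U M : 'M[C]_n) : U \is unitarymx ->
  U *m (U^t* *m M *m U) *m U^t* = M.
Proof.
move=> uU; rewrite !mulmxA unitarymx_mulCV// mul1mx -mulmxA.
by rewrite unitarymx_mulCV// mulmx1.
Qed.

Lemma det_unitary_conj n (U M : 'M[C]_n) : U \is unitarymx ->
  \det (U^t* *m M *m U) = \det M.
Proof.
move=> uU; rewrite 2!det_mulmx mulrAC -det_mulmx unitarymx_mulVC//.
by rewrite det1 mul1r.
Qed.

Lemma invmx_gram n (S : 'M[C]_n) : S^t* = S -> S \in unitmx ->
  (invmx S)^t* *m S *m invmx S = invmx S.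
Proof. by move=> hS uS; rewrite trmx_inv map_invmx hS mulVmx// mul1mx. Qed.

(** For unitary [U], the orthogonal projection onto the span of the adjoints of its first [r] rows.
    If [U] diagonalizes a Hermitian matrix with decreasing eigenvalues, these are [r] leading
    eigenvectors. *)
Definition topproj n r (U : 'M[C]_n) : 'M[C]_n := U^t* *m pid_mx r *m U.

Lemma adjmx_topproj n r (U : 'M[C]_n) : (topproj r U)^t* = topproj r U.
Proof. by rewrite /topproj !adjmx_mul trmxCK adjmx_pid mulmxA. Qed.

Lemma topproj_idem n r (U : 'M[C]_n) : U \is unitarymx -> (r <= n)%N ->
  topproj r U *m topproj r U = topproj r U.
Proof.
move=> uU rn; rewrite /topproj !mulmxA mulmxtVK//.
by rewrite -(mulmxA (U^t* )) pid_mx_id.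
Qed.

Lemma rank_topproj n r (U : 'M[C]_n) : U \is unitarymx -> (r <= n)%N ->
  \rank (topproj r U) = r.
Proof.
move=> uU rn; rewrite /topproj -mulmxA eqmxMfull ?mxrankMfree ?rank_pid_mx//.
  by rewrite row_free_unit unitarymx_unit.
by rewrite row_full_unit unitarymx_unit// trmxC_unitary.
Qed.

Lemma mxtrace_mul_conj n (X U M : 'M[C]_n) :
  \tr (X *m (U^t* *m M *m U)) = \tr (U *m X *m U^t* *m M).
Proof. by rewrite !mulmxA mxtrace_mulC !mulmxA. Qed.

Lemma mxtrace_topproj_conj n r (U M : 'M[C]_n) : U \is unitarymx ->
  \tr (topproj r U *m (U^t* *m M *m U)) = \tr ((pid_mx r : 'M[C]_n) *m M).
Proof.
move=> uU; rewrite mxtrace_mul_conj /topproj !mulmxA unitarymx_mulCV// mul1mx.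
by rewrite mulmxtVK.
Qed.

Lemma adjmxZ m n (a : C) (A : 'M[C]_(m, n)) : (a *: A)^t* = Num.conj a *: A^t*.
Proof. by apply/matrixP => i j; rewrite !mxE rmorphM. Qed.

Lemma mxtrace_adj n (A : 'M[C]_n) : \tr (A^t* ) = Num.conj (\tr A).
Proof. by rewrite trace_map_mx mxtrace_tr. Qed.

Lemma mxtrace_adjmul m n (A B : 'M[C]_(m, n)) :
  \tr (A^t* *m B) = Num.conj (\tr (B^t* *m A)).
Proof. by rewrite -mxtrace_adj adjmx_mul trmxCK. Qed.

Lemma mxtrace_sqr_comb m n (a b : C) (A B : 'M[C]_(m, n)) :
  Num.conj a = a -> Num.conj b = b ->
  \tr ((a *: A - b *: B)^t* *m (a *: A - b *: B)) =
  a ^+ 2 * \tr (A^t* *m A) - a * b * \tr (A^t* *m B)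
  - a * b * \tr (B^t* *m A) + b ^+ 2 * \tr (B^t* *m B).
Proof.
move=> ra rb; rewrite adjmxB !adjmxZ ra rb.
rewrite mulmxBl !mulmxBr -!scalemxAl -!scalemxAr !raddfB/= !mxtraceZ.
by ring.
Qed.

Lemma mulmx_adj_ge0 m n (B : 'M[C]_(m, n)) i :
  0 <= (B *m B^t* ) i i.
Proof.
by rewrite mxE; apply: sumr_ge0 => j _; rewrite !mxE; exact: mul_conjC_ge0.
Qed.

(** Column [i] of [G m] is column [m] of [A i], so both sides are the same triple sum. It converts
    the sum over beams that defines [Pmx] into a combination of correlations. *)
Lemma sum_sandwich_mx n p q (A : 'I_n -> 'M[C]_(p, q))
    (G : 'I_q -> 'M[C]_(p, n)) (X : 'M[C]_n) :
  (forall m a i, G m a i = A i a m) ->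
  \sum_m G m *m X *m (G m)^t* = \sum_i \sum_j X i j *: (A i *m (A j)^t* ).
Proof.
move=> GE; apply/matrixP => a b; rewrite !summxE.
transitivity (\sum_m \sum_j \sum_i A i a m * X i j * Num.conj (A j b m)).
  apply: eq_bigr => m _; rewrite mxE; apply: eq_bigr => j _.
  rewrite mxE big_distrl/=; apply: eq_bigr => i _.
  by rewrite [(_^t* ) j b]mxE [(_^T) j b]mxE !GE.
transitivity (\sum_i \sum_j \sum_m A i a m * X i j * Num.conj (A j b m)).
  rewrite exchange_big/= [RHS]exchange_big/=; apply: eq_bigr => j _.
  exact: exchange_big.
apply: eq_bigr => i _; rewrite summxE; apply: eq_bigr => j _.
rewrite mxE [(A i *m _) a b]mxE big_distrr/=; apply: eq_bigr => m _.
by rewrite [(_^t* ) m b]mxE [(_^T) m b]mxE mulrA [X i j * _]mulrC.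
Qed.

End ConjugateTranspose.

(** * Positive semidefinite matrices and sorted spectra *)

Section HermitianEigenvalues.
Context {R : realType}.
Local Notation C := R[i].

Lemma Re_add (x y : C) : complex.Re (x + y) = complex.Re x + complex.Re y.
Proof. by case: x y => [? ?] [? ?]. Qed.

Lemma Re_opp (x : C) : complex.Re (- x) = - complex.Re x.
Proof. by case: x. Qed.

Lemma Re_sum I (r : seq I) (Q : pred I) (F : I -> C) :
  complex.Re (\sum_(i <- r | Q i) F i) = \sum_(i <- r | Q i) complex.Re (F i).
Proof. by apply: (big_morph _ Re_add). Qed.

Lemma Re_mulrl (a : R) (x : C) : complex.Re (a%:C * x) = a * complex.Re x.
Proof. by case: x => u v /=; rewrite mul0r subr0. Qed.

Lemma Re_mulrr (a : R) (x : C) : complex.Re (x * a%:C) = complex.Re x * a.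
Proof. by rewrite mulrC Re_mulrl mulrC. Qed.

Lemma psdmxC_congr m n (A : 'M[C]_n) (B : 'M[C]_(n, m)) :
  psdmxC A -> psdmxC (B^t* *m A *m B).
Proof.
move=> [hA pA]; split; first by rewrite !adjmx_mul trmxCK hA mulmxA.
by move=> x; have := pA (B *m x); rewrite adjmx_mul !mulmxA.
Qed.

Lemma psdmxC_diag_ge0 n (A : 'M[C]_n) i : psdmxC A -> 0 <= complex.Re (A i i).
Proof.
move=> [_ /(_ (delta_mx i 0))].
rewrite trmx_delta map_delta_mx -rowE -colE !mxE.
by rewrite lecE => /andP[_].
Qed.

Lemma orthoprojmx_psd n (A : 'M[C]_n) : orthoprojmx A -> psdmxC A.
Proof.
move=> [hA iA]; split => // x.
rewrite -iA -{1}hA mulmxA -adjmx_mul -mulmxA mxE; apply: sumr_ge0 => i _.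
by rewrite !mxE mulrC; exact: mul_conjC_ge0.
Qed.

Lemma projection_relaxed n r (A : 'M[C]_n) :
  projection_constraint r A -> relaxed_constraint r A.
Proof.
move=> [[hA iA] rA pA]; split; [exact: pA| |by rewrite mxtrace_idempotent ?rA].
apply: orthoprojmx_psd; split; first by rewrite adjmxB adjmx1 hA.
by rewrite mulmxBl !mulmxBr !mul1mx mulmx1 iA subrr subr0.
Qed.

(** Both lists split the same characteristic polynomial into linear factors, hence agree up to
    order. *)
Lemma eigvals_unitary_diag n (U : 'M[C]_n) (D : 'rV[C]_n) : U \is unitarymx ->
  perm_eq (eigvals (U^t* *m diag_mx D *m U)) [seq D 0 i | i : 'I_n].
Proof.
move=> uU; apply: prod_XsubC_eq; rewrite /eigvals.
case: closed_field_poly_normal => s /= sE.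
rewrite big_image/= -(char_poly_unitary_diag D uU) [RHS]sE.
by rewrite (monicP (char_poly_monic _)) scale1r.
Qed.

(** The spectral theorem gives a diagonalization in some order; the permutation [sg] that sorts the
    eigenvalues is absorbed into the unitary factor. The eigenvalues are real, so passing to real
    parts changes nothing. *)
Lemma hermitian_sorted_spectral n (A : 'M[C]_n) : A^t* = A ->
  exists2 U : 'M[C]_n, U \is unitarymx &
    A = U^t* *m diag_mx (\row_i (eigval A i.+1)%:C) *m U.
Proof.
move=> hA; have hermA : A \is hermsymmx.
  by apply/is_hermitianmxP; rewrite expr0 scale1r hA.
have /orthomx_spectralP := hermitian_normalmx hermA.
have /mxOverP dr := hermitian_spectral_diag_real hermA.
set P := spectralmx A; set D := spectral_diag A in dr *.
have uP : P \is unitarymx by exact: spectral_unitarymx.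
rewrite invmx_unitary// => AE.
pose geR (x y : R) := y <= x.
pose s := sort geR [seq complex.Re z | z <- eigvals A].
have : perm_eq s [tuple complex.Re (D 0 i) | i < n].
  rewrite /s (perm_trans (_ : perm_eq _ [seq complex.Re z | z <- eigvals A]))//.
    by rewrite perm_sort.
  rewrite /= (map_comp (@complex.Re R) (D 0)); apply: perm_map.
  by rewrite {1}AE eigvals_unitary_diag.
move=> /tuple_permP[sg sE].
have eE i : eigval A (i : 'I_n).+1 = complex.Re (D 0 (sg i)).
  by rewrite /eigval -/s /= sE nth_mktuple tnth_mktuple.
exists (perm_mx sg *m P); first exact: unitarymx_perm.
apply: etrans AE _; apply: etrans (esym (perm_mx_conj_diag sg P D)) _.
congr (_ *m diag_mx _ *m _).
by apply/rowP => i; rewrite !mxE eE RRe_real.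
Qed.

Lemma eigval_le n (A : 'M[C]_n) i j : (i <= j < n)%N ->
  eigval A j.+1 <= eigval A i.+1.
Proof.
move=> /andP[ij jn].
rewrite /eigval; set s := sort _ _.
(* The list has exactly [n] entries, so the default [0] of [nth] is never returned. *)
have sz : size s = n.
  rewrite size_sort size_map /eigvals; case: closed_field_poly_normal => r /= rE.
  apply/succn_inj; rewrite -(size_char_poly A) rE.
  rewrite (monicP (char_poly_monic A)) scale1r size_prod_XsubC//.
have := @sorted_leq_nth _ (fun x y : R => y <= x) _ _ 0 s.
apply => //.
- by move=> x y z /[swap]; exact: le_trans.
- by apply: sort_sorted => x y; exact: le_total.
- by rewrite inE sz; exact: leq_ltn_trans jn.
- by rewrite inE sz.
Qed.

End HermitianEigenvalues.

(** * Ky Fan's inequality with a quantitative gap *)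

Section KyFan.
Context {R : realType}.
Local Notation C := R[i].

Lemma topproj_constraint n r (U : 'M[C]_n) : U \is unitarymx -> (r <= n)%N ->
  projection_constraint r (topproj r U).
Proof.
move=> uU rn.
have P : orthoprojmx (topproj r U).
  by split; [exact: adjmx_topproj | exact: topproj_idem].
by split; [|exact: rank_topproj|exact: orthoprojmx_psd].
Qed.

Lemma Re_mxtrace_mul_diag n (X : 'M[C]_n) (e : 'I_n -> R) :
  complex.Re (\tr (X *m diag_mx (\row_i (e i)%:C))) =
  \sum_i complex.Re (X i i) * e i.
Proof.
by rewrite mul_mx_diag Re_sum; apply: eq_bigr => i _; rewrite !mxE Re_mulrr.
Qed.

Lemma pid_mx_diag n r :
  pid_mx r = diag_mx (\row_i ((i < r)%N%:R : R)%:C) :> 'M[C]_n.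
Proof.
apply/matrixP => i j; rewrite !mxE -(inj_eq val_inj)/=.
by case: eqP => _ //=; rewrite rmorph_nat mulr1n.
Qed.

Lemma sumr_lt_ord n r (F : nat -> R) : (r <= n)%N ->
  \sum_(i < n | (i < r)%N) F i = \sum_(0 <= i < r) F i.
Proof. by move=> rn; rewrite big_mkord (big_ord_widen _ _ rn). Qed.

Lemma sumr_eigvalE n r (A : 'M[C]_n) : (r <= n)%N ->
  \sum_(1 <= i < r.+1) eigval A i = \sum_(i < n | (i < r)%N) eigval A i.+1.
Proof. by move=> rn; rewrite (sumr_lt_ord _ rn) big_add1. Qed.

Lemma Re_mxtrace_topproj n r (U : 'M[C]_n) (e : 'I_n -> R) : U \is unitarymx ->
  complex.Re (\tr (topproj r U *m (U^t* *m diag_mx (\row_i (e i)%:C) *m U))) =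
  \sum_(i < n | (i < r)%N) e i.
Proof.
move=> uU; rewrite mxtrace_topproj_conj// Re_mxtrace_mul_diag [RHS]big_mkcond.
by apply: eq_bigr => i _; rewrite mxE eqxx /=; case: (i < r)%N;
  rewrite ?mul1r ?mul0r.
Qed.

(** In the basis given by [U], the diagonal entries [p i] of [W] lie in [0, 1] and sum to [r]. The
    mass missing from the first [r] positions, where [e] is at least [c], must sit where [e] is at
    most [c'], and each unit moved costs at least [c - c']. *)
Lemma ky_fan_gap n r (U W : 'M[C]_n) (e : 'I_n -> R) (c c' : R) :
  U \is unitarymx -> (r <= n)%N -> relaxed_constraint r W ->
  (forall i : 'I_n, (i < r)%N -> c <= e i) ->
  (forall i : 'I_n, (r <= i)%N -> e i <= c') ->
  (c - c') * (r%:R - complex.Re (\tr (W *m topproj r U))) <=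
  \sum_(i < n | (i < r)%N) e i -
    complex.Re (\tr (W *m (U^t* *m diag_mx (\row_i (e i)%:C) *m U))).
Proof.
move=> uU rn [pW p1W tW] ce ec.
pose X := U *m W *m U^t*; pose p i := complex.Re (X i i).
have p0 i : 0 <= p i.
  apply: psdmxC_diag_ge0; rewrite /X -{1}(trmxCK U); exact: psdmxC_congr.
have p1 i : p i <= 1.
  have : psdmxC (1%:M - X).
    have -> : 1%:M - X = U^t*^t* *m (1%:M - W) *m U^t*.
      by rewrite trmxCK mulmxBr mulmxBl mulmx1 unitarymx_mulCV.
    exact: psdmxC_congr.
  move=> /(psdmxC_diag_ge0 i).
  by rewrite mxE [1%:M i i]mxE [(- X) i i]mxE eqxx Re_add Re_opp subr_ge0.
have sp : \sum_i p i = r%:R.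
  rewrite -Re_sum -/(\tr X) /X mxtrace_mulC mulmxA unitarymx_mulVC// mul1mx tW.
  by rewrite -(rmorph_nat (real_complex R)).
have E1 : complex.Re (\tr (W *m topproj r U)) = \sum_(i < n | (i < r)%N) p i.
  apply: etrans (congr1 (@complex.Re R) (mxtrace_mul_conj W U (pid_mx r))) _.
  apply: etrans (congr1 (fun M => complex.Re (\tr (X *m M))) (pid_mx_diag n r)) _.
  apply: etrans (Re_mxtrace_mul_diag X _) _.
  rewrite [RHS]big_mkcond; apply: eq_bigr => i _.
  by rewrite -/(p i); case: (i < r)%N; rewrite ?mulr1 ?mulr0.
have E2 : complex.Re (\tr (W *m (U^t* *m diag_mx (\row_i (e i)%:C) *m U))) =
    \sum_i p i * e i.
  apply: etrans (congr1 (@complex.Re R) (mxtrace_mul_conj W U _)) _.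
  exact: Re_mxtrace_mul_diag.
(* Abstracting the traces keeps unification from unfolding matrix products. *)
suff H t1 t2 : t1 = \sum_(i < n | (i < r)%N) p i -> t2 = \sum_i p i * e i ->
    (c - c') * (r%:R - t1) <= \sum_(i < n | (i < r)%N) e i - t2.
  exact: H E1 E2.
move=> -> -> {E1 E2}.
have rE : r%:R = \sum_(i < n | (i < r)%N) 1 :> R.
  rewrite (sumr_lt_ord (fun=> 1) rn) big_mkord sumr_const card_ord.
  by rewrite -[RHS]mulr_natr mul1r.
(* The loss on the leading positions is the sum of [(1 - p i) * e i], with [1 - p i] nonnegative and
   [e i >= c]. *)
have S1 : c * (r%:R - \sum_(i < n | (i < r)%N) p i) <=
    \sum_(i < n | (i < r)%N) e i - \sum_(i < n | (i < r)%N) p i * e i.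
  rewrite rE -!sumrB mulr_sumr; apply: ler_sum => i ir.
  rewrite -{1}[e i]mul1r -mulrBl mulrC ler_wpM2l ?subr_ge0 ?ce//.
have S2 : \sum_(i < n | ~~ (i < r)%N) p i * e i <=
    c' * \sum_(i < n | ~~ (i < r)%N) p i.
  rewrite mulr_sumr; apply: ler_sum => i; rewrite -leqNgt => ri.
  by rewrite mulrC ler_wpM2r ?ec.
have pD : \sum_i p i = \sum_(i < n | (i < r)%N) p i +
    \sum_(i < n | ~~ (i < r)%N) p i by rewrite (bigID (fun i : 'I_n => (i < r)%N)).
have peD : \sum_i p i * e i = \sum_(i < n | (i < r)%N) p i * e i +
    \sum_(i < n | ~~ (i < r)%N) p i * e i by rewrite (bigID (fun i : 'I_n => (i < r)%N)).
move: S1 S2; rewrite peD -sp pD.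
by lra.
Qed.

(** Both thresholds of [ky_fan_gap] are set to the [r]-th eigenvalue, so that its left side
    vanishes. *)
Lemma ky_fan n r (A W : 'M[C]_n) : A^t* = A -> (0 < r <= n)%N ->
  relaxed_constraint r W ->
  complex.Re (\tr (W *m A)) <= \sum_(1 <= i < r.+1) eigval A i.
Proof.
move=> hA /andP[r0 rn] cW; have [U uU AE] := hermitian_sorted_spectral hA.
have := @ky_fan_gap n r U W (fun i => eigval A i.+1) (eigval A r) (eigval A r)
  uU rn cW.
rewrite -AE subrr mul0r subr_ge0 sumr_eigvalE//; apply => i ir.
  by rewrite -{1}(prednK r0) eigval_le//; move: rn ir; lia.
by rewrite -{1}(prednK r0) eigval_le//; rewrite ltn_ord andbT; move: ir; lia.
Qed.

(** The last clause is the stability of the maximizer: among projections of rank [r],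
    [r - Re tr (W' W)] is half the squared distance from [W'] to [W], so the loss grows at least
    like the gap times that quantity. *)
Lemma top_projection n r (A : 'M[C]_n) : A^t* = A -> (0 < r < n)%N ->
  exists W : 'M[C]_n, [/\ projection_constraint r W,
    complex.Re (\tr (W *m A)) = \sum_(1 <= i < r.+1) eigval A i &
    forall W', relaxed_constraint r W' ->
      (eigval A r - eigval A r.+1) * (r%:R - complex.Re (\tr (W' *m W))) <=
      complex.Re (\tr (W *m A)) - complex.Re (\tr (W' *m A))].
Proof.
move=> hA /andP[r0 rn]; have [U uU AE] := hermitian_sorted_spectral hA.
have tE : complex.Re (\tr (topproj r U *m A)) =
    \sum_(i < n | (i < r)%N) eigval A i.+1.
  by rewrite {1}AE Re_mxtrace_topproj.
exists (topproj r U); split; first by apply: topproj_constraint => //; exact: ltnW.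
  by rewrite tE sumr_eigvalE// ltnW.
move=> W' cW'; rewrite tE.
rewrite {4}AE; apply: ky_fan_gap => //; first exact: ltnW.
  by move=> i ir; rewrite -{1}(prednK r0) eigval_le//; move: rn ir; lia.
by move=> i ri; rewrite eigval_le// ri ltn_ord.
Qed.

(** The squared Frobenius norm. *)
Definition sqnormmx m n (X : 'M[C]_(m, n)) : R := complex.Re (\tr (X^t* *m X)).

Lemma sqnormmx_ge0 m n (X : 'M[C]_(m, n)) : 0 <= sqnormmx X.
Proof.
rewrite /sqnormmx /mxtrace Re_sum; apply: sumr_ge0 => i _.
rewrite mxE Re_sum; apply: sumr_ge0 => j _; rewrite !mxE mulrC.
by have := mul_conjC_ge0 (X j i); rewrite lecE => /andP[_].
Qed.

Lemma sqnormmx_projB n r (W W' : 'M[C]_n) :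
  projection_constraint r W -> projection_constraint r W' ->
  sqnormmx (W - W') = 2 * (r%:R - complex.Re (\tr (W *m W'))).
Proof.
move=> cW cW'.
have [_ _ tW] := projection_relaxed cW.
have [_ _ tW'] := projection_relaxed cW'.
move: cW cW' => [[hW iW] _ _] [[hW' iW'] _ _].
have E : \tr ((W - W')^t* *m (W - W')) = r%:R *+ 2 - \tr (W *m W') *+ 2.
  rewrite adjmxB hW hW' mulmxBl !mulmxBr iW iW' !raddfB/= (mxtrace_mulC W') tW tW'.
  by ring.
rewrite /sqnormmx E -(rmorph_nat (real_complex R)) !mulr2n.
by rewrite !(Re_add, Re_opp) /=; lra.
Qed.

(* Completing the square: this is [|2 t B - g D|^2 >= 0] divided by [g]. *)
Lemma sqnormmx_square n (D B : 'M[C]_n) (g t : R) : D^t* = D -> 0 < g ->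
  4 * t * complex.Re (\tr (D *m B)) <=
  g * sqnormmx D + 4 * t ^+ 2 * (sqnormmx B / g).
Proof.
move=> hD g0.
have E := mxtrace_sqr_comb B D (conjc_real (2 * t)) (conjc_real g).
have F : complex.Re (\tr (B^t* *m D)) = complex.Re (\tr (D *m B)).
  by rewrite mxtrace_adjmul hD; case: (\tr _).
have ReE x y z w : complex.Re ((2 * t)%:C ^+ 2 * x - (2 * t)%:C * g%:C * y
      - (2 * t)%:C * g%:C * z + g%:C ^+ 2 * w) =
    (2 * t) ^+ 2 * complex.Re x - 2 * t * g * complex.Re y
      - 2 * t * g * complex.Re z + g ^+ 2 * complex.Re w.
  by rewrite -!rmorphXn -!rmorphM !(Re_add, Re_opp, Re_mulrl).
have := sqnormmx_ge0 ((2 * t)%:C *: B - g%:C *: D).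
rewrite [X in 0 <= X](etrans (congr1 (@complex.Re R) E) (ReE _ _ _ _)) F hD.
rewrite /sqnormmx hD; move: g0.
move: (complex.Re _) (complex.Re _) (complex.Re _); clear => d x b g0 H.
rewrite -[leRHS](_ : (g ^+ 2 * d + 4 * t ^+ 2 * b) / g = _); last first.
  by field; rewrite gt_eqF.
by rewrite ler_pdivlMr//; lra.
Qed.

End KyFan.

(** * Duality for the linear matrix inequalities *)

Section RealQuadratic.
Context {R : realType}.

Lemma mxtrace_quad n m (J : 'M[R]_n) (L : 'M[R]_(n, m)) :
  \tr (L^T *m J *m L) = \sum_l ((col l L)^T *m J *m col l L) 0 0.
Proof.
apply: eq_bigr => l _; rewrite !mxE; apply: eq_bigr => k _; rewrite !mxE.
by congr (_ * _); apply: eq_bigr => i _; rewrite !mxE.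
Qed.

(** The bordered matrix is the congruence of [J] by the row [[1 w]]. This yields feasibility of the
    optimal projection. *)
Lemma psd_block n (J : 'M[R]_n) (w : 'cV[R]_n) : psdmxR J ->
  psdmxR (block_mx J (J *m w) (J *m w)^T (((w^T *m J *m w) 0 0)%:M : 'M[R]_1)).
Proof.
move=> [sJ pJ]; rewrite -mx11_scalar.
have -> : block_mx J (J *m w) (J *m w)^T (w^T *m J *m w) =
    (row_mx 1%:M w)^T *m J *m row_mx 1%:M w.
  by rewrite tr_row_mx mul_col_mx mul_col_row trmx1 !mulmx1 mul1mx trmx_mul sJ.
split; first by rewrite !trmx_mul trmxK sJ mulmxA.
by move=> x; have := pJ (row_mx 1%:M w *m x); rewrite trmx_mul !mulmxA.
Qed.

(** Evaluation of the quadratic form at the vector [(w, -1)]; this is the weak duality half of the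
    argument. *)
Lemma psd_block_lb n (J : 'M[R]_n) (b w : 'cV[R]_n) (d : R) :
  psdmxR (block_mx J b b^T (d%:M : 'M[R]_1)) ->
  2 * (w^T *m b) 0 0 - (w^T *m J *m w) 0 0 <= d.
Proof.
move=> [_ /(_ (col_mx w (- 1%:M)))].
rewrite tr_col_mx mul_row_block mul_row_col linearN/= trmx1.
rewrite !mulNmx !mulmxN !mul1mx !mulmx1.
rewrite mulmxBl opprB [b^T *m w](_ : _ = w^T *m b); last first.
  by rewrite [RHS](mx11_scalar) -tr_scalar_mx -mx11_scalar trmx_mul trmxK.
by rewrite !mxE eqxx mulr1n; lra.
Qed.

Lemma le0_of_quadratic_bound (g K : R) :
  (forall t, 0 < t -> t * g <= t ^+ 2 * K) -> g <= 0.
Proof.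
move=> H; rewrite leNgt; apply/negP => g0.
have k0 : 0 < `|K| + 1 by rewrite ltr_wpDl.
(* For this [t] the product [t * K] is at most [g / 2], which contradicts the bound after division
   by [t]. *)
have t0 : 0 < g / (2 * (`|K| + 1)) by rewrite divr_gt0// mulr_gt0.
have := H _ t0; rewrite expr2 -mulrA ler_pM2l//; apply/negP; rewrite -ltNge.
rewrite mulrAC ltr_pdivrMr ?mulr_gt0//.
by have := ler_norm K; nra.
Qed.

Lemma mxtrace_sqr_le0 m n (X : 'M[R]_(m, n)) : \tr (X^T *m X) <= 0 -> X = 0.
Proof.
move=> H; have X0 : forall j i, 0 <= X^T j i * X i j.
  by move=> j i; rewrite mxE -expr2 sqr_ge0.
have : \tr (X^T *m X) == 0.
  rewrite eq_le H /mxtrace sumr_ge0// => j _; rewrite mxE sumr_ge0//.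
rewrite /mxtrace psumr_eq0; last by move=> j _; rewrite mxE sumr_ge0.
move=> /allP X2; apply/matrixP => i j; rewrite mxE.
have := X2 j (mem_index_enum _); rewrite mxE psumr_eq0// => /allP /(_ i).
by rewrite mem_index_enum mxE mulf_eq0 orbb => /(_ isT)/eqP.
Qed.

End RealQuadratic.

(** * First-order optimality at the dual maximizer *)

Section DualCertificate.
Context {R : realType} {n N : nat}.
Local Notation C := R[i].
Variable K : 'I_n -> 'I_n -> 'M[C]_N.

Definition mxcomb (X : 'M[R]_n) : 'M[C]_N :=
  \sum_i \sum_j (X i j)%:C *: K i j.

Definition mxinfo (W : 'M[C]_N) : 'M[R]_n :=
  \matrix_(i, j) (2 * complex.Re (\tr (W *m K i j))).

Lemma mxinfoB W W' : mxinfo (W - W') = mxinfo W - mxinfo W'.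
Proof.
apply/matrixP => i j; rewrite !mxE mulmxBl raddfB/= Re_add Re_opp.
by rewrite mulrBr.
Qed.

(** Up to the factor 2, [mxinfo] and [mxcomb] are adjoint for the real trace pairings; this
    exchanges quadratic forms of the information matrix for linear functionals of [W]. *)
Lemma mxtrace_mxinfo W X :
  \tr (mxinfo W *m X^T) = 2 * complex.Re (\tr (W *m mxcomb X)).
Proof.
rewrite /mxcomb mulmx_sumr (raddf_sum (@mxtrace C N)) Re_sum mulr_sumr.
apply: eq_bigr => i _.
rewrite mulmx_sumr (raddf_sum (@mxtrace C N)) Re_sum mulr_sumr !mxE.
apply: eq_bigr => j _.
by rewrite /= -scalemxAr mxtraceZ Re_mulrl !mxE mulrA mulrAC.
Qed.

Lemma mxtrace_mxinfo_quad W (L : 'M[R]_n) :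
  \tr (L^T *m mxinfo W *m L) = 2 * complex.Re (\tr (W *m mxcomb (L *m L^T))).
Proof.
by rewrite -mxtrace_mxinfo trmx_mul trmxK -mulmxA mxtrace_mulC mulmxA.
Qed.

Hypothesis K_herm : forall i j, (K i j)^t* = K j i.

Lemma mxinfo_sym W : W^t* = W -> (mxinfo W)^T = mxinfo W.
Proof.
move=> hW; apply/matrixP => i j; rewrite !mxE; congr (2 * _).
rewrite -{1}hW mxtrace_adjmul K_herm mxtrace_mulC.
by case: (\tr _).
Qed.

Lemma mxcomb_herm X : X^T = X -> (mxcomb X)^t* = mxcomb X.
Proof.
move=> sX; rewrite /mxcomb !raddf_sum exchange_big/=; apply: eq_bigr => j _.
rewrite !raddf_sum/=; apply: eq_bigr => i _.
rewrite adjmxZ K_herm -{1}sX mxE; congr (_ *: _); exact: conjc_real.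
Qed.

Hypothesis K_psd : forall x : 'cV[R]_n, psdmxC (mxcomb (x *m x^T)).

(** By adjointness the quadratic form at [x] is a trace against [mxcomb (x *m x^T)], and since [W]
    is an orthogonal projection that trace is the one of a semidefinite matrix sandwiched between
    two copies of [W]. *)
Lemma mxinfo_psd W : orthoprojmx W -> psdmxR (mxinfo W).
Proof.
move=> [hW iW]; split; first exact: mxinfo_sym.
move=> x; rewrite -trace_mx11 -mulmxA mxtrace_mulC -mulmxA.
rewrite -[x *m x^T]trmxK trmx_mul trmxK mxtrace_mxinfo mulr_ge0//.
have -> : \tr (W *m mxcomb (x *m x^T)) = \tr (W^t* *m mxcomb (x *m x^T) *m W).
  by rewrite hW -[in RHS]mulmxA [RHS]mxtrace_mulC -[in RHS]mulmxA iW mxtrace_mulC.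
rewrite /mxtrace Re_sum; apply: sumr_ge0 => i _.
exact/psdmxC_diag_ge0/psdmxC_congr/K_psd.
Qed.

Variables (r : nat) (JP : 'M[R]_n) (s : 'rV[R]_n).
Hypotheses (r_range : (0 < r < N)%N) (JP_psd : psdmxR JP).

Definition dual_value (L : 'M[R]_n) : R :=
  2 * \tr (L *m diag_mx s) - \tr (L^T *m JP *m L)
  - 2 * \sum_(1 <= i < r.+1) eigval (mxcomb (L *m L^T)) i.

Variable Lam : 'M[R]_n.
Hypothesis Lam_max : forall L, dual_value L <= dual_value Lam.
Hypothesis gap : eigval (mxcomb (Lam *m Lam^T)) r.+1 <
  eigval (mxcomb (Lam *m Lam^T)) r.

Lemma mxcomb_gram_herm (L : 'M[R]_n) : (mxcomb (L *m L^T))^t* = mxcomb (L *m L^T).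
Proof. by rewrite mxcomb_herm// trmx_mul trmxK. Qed.

Lemma mxtrace_quad_expand (J L D : 'M[R]_n) (t : R) : J^T = J ->
  \tr ((L + t *: D)^T *m J *m (L + t *: D)) = \tr (L^T *m J *m L)
   + 2 * t * \tr (D^T *m J *m L) + t ^+ 2 * \tr (D^T *m J *m D).
Proof.
move=> sJ; have -> : (L + t *: D)^T = L^T + t *: D^T.
  by apply/matrixP => i j; rewrite !mxE.
rewrite !mulmxDl !mulmxDr -!scalemxAl -!scalemxAr.
rewrite !mxtraceD !mxtraceZ.
have -> : \tr (L^T *m J *m D) = \tr (D^T *m J *m L).
  by rewrite -mxtrace_tr !trmx_mul trmxK sJ mulmxA.
by ring.
Qed.

Lemma mxtrace_infoD W (L : 'M[R]_n) :
  \tr (L^T *m JP *m L) + 2 * complex.Re (\tr (W *m mxcomb (L *m L^T))) =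
  \tr (L^T *m (mxinfo W + JP) *m L).
Proof.
by rewrite mulmxDr mulmxDl mxtraceD -(mxtrace_mxinfo_quad W L) addrC.
Qed.

(** The scalar skeleton of the perturbation argument, with every trace replaced by a real variable.
    The gap inequality contributes [- g * n2], which cancels the [g * n2] coming from the completed
    square; what is left is of order [t ^+ 2]. *)
Lemma stationary_arith (t g rr ww n2 b ls ds lts qP qPt qPD St S0 E Tt T0t T0 TD
    X X0 XB JLt JL JD : R) :
  2 * lts - qPt - 2 * St <= 2 * ls - qP - 2 * S0 ->
  Tt = St -> T0 = S0 -> TD <= E -> g * (rr - ww) <= T0 - T0t ->
  4 * t * XB <= g * n2 + 4 * t ^+ 2 * b -> n2 = 2 * (rr - ww) ->
  qPt + 2 * Tt = JLt -> qP + 2 * T0t = JL -> qPD + 2 * TD = JD ->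
  JLt = JL + 2 * t * X + t ^+ 2 * JD -> X = X0 + 2 * XB -> lts = ls + t * ds ->
  t * (2 * (ds - X0)) <= t ^+ 2 * (2 * E + qPD + 4 * b).
Proof.
move=> H1 h2 h3 H4 H5 H6 h7 h8 h9 h10 h11 h12 h13.
have H : t ^+ 2 * TD <= t ^+ 2 * E by rewrite ler_wpM2l// sqr_ge0.
by subst; lra.
Qed.

(* Perturb [Lam] to [Lam + t D] and let [Wt] be the top projection there.  By
   the eigenvalue gap the loss of [Wt] at [Lam] is at least a multiple of
   [|Wt - W|^2], which absorbs the first-order change [t <Wt - W, .>]; only
   [t] times the gradient at [W] survives, up to [O(t^2)]. *)
Lemma stationary_le0 W D : projection_constraint r W ->
  complex.Re (\tr (W *m mxcomb (Lam *m Lam^T))) =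
    \sum_(1 <= i < r.+1) eigval (mxcomb (Lam *m Lam^T)) i ->
  (forall W', relaxed_constraint r W' ->
      (eigval (mxcomb (Lam *m Lam^T)) r - eigval (mxcomb (Lam *m Lam^T)) r.+1) *
        (r%:R - complex.Re (\tr (W' *m W))) <=
      complex.Re (\tr (W *m mxcomb (Lam *m Lam^T))) -
      complex.Re (\tr (W' *m mxcomb (Lam *m Lam^T)))) ->
  \tr (D^T *m (diag_mx s - (mxinfo W + JP) *m Lam)) <= 0.
Proof.
move=> cW trW gapW; set g := _ - _ in gapW.
have g0 : 0 < g by rewrite subr_gt0.
pose B := mxcomb (D *m Lam^T).
(* By Ky Fan, [E] bounds the second-order term for every projection [Wt], so the constant [Q] is
   independent of [t]. *)
pose E := \sum_(1 <= i < r.+1) eigval (mxcomb (D *m D^T)) i.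
pose Q := 2 * E + \tr (D^T *m JP *m D) + 4 * (sqnormmx B / g).
suff H t : 0 < t -> t * (2 * \tr (D^T *m (diag_mx s - (mxinfo W + JP) *m Lam)))
    <= t ^+ 2 * Q.
  have := le0_of_quadratic_bound H.
  by rewrite pmulr_rle0.
move=> t0; pose Lt := Lam + t *: D.
have [Wt [cWt trWt _]] := top_projection (mxcomb_gram_herm Lt) r_range.
have rN : (0 < r <= N)%N by case/andP: r_range => -> /ltnW.
have kfD := ky_fan (mxcomb_gram_herm D) rN (projection_relaxed cWt).
have [[hWt _] _ _] := cWt; have [[hW _] _ _] := cW.
have hD : (Wt - W)^t* = Wt - W by rewrite adjmxB hWt hW.
have gW := gapW _ (projection_relaxed cWt).
have sq := sqnormmx_square B t hD g0.
have sqE := sqnormmx_projB cWt cW.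
have sJ : (mxinfo Wt + JP)^T = mxinfo Wt + JP.
  by rewrite linearD/= mxinfo_sym//; case: JP_psd => ->.
(* The information matrix is affine in the projection, so the first-order term at [Wt] is the one at
   [W] plus the displacement [Wt - W] paired with [B]. *)
have crossE : \tr (D^T *m (mxinfo Wt + JP) *m Lam) =
    \tr (D^T *m ((mxinfo W + JP) *m Lam)) +
    2 * complex.Re (\tr ((Wt - W) *m B)).
  rewrite -mxtrace_mxinfo mxinfoB trmx_mul trmxK (mulmxA _ Lam) (mxtrace_mulC _ D^T).
  rewrite -mxtraceD -mulmxA -mulmxDr -mulmxDl; congr (\tr (_ *m (_ *m _))).
  by rewrite addrAC addrCA subrr addr0 addrC.
have linE : \tr (Lt *m diag_mx s) = \tr (Lam *m diag_mx s) + t * \tr (D^T *m diag_mx s).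
  rewrite mulmxDl -scalemxAl mxtraceD mxtraceZ; congr (_ + _ * _).
  by rewrite -mxtrace_tr trmx_mul tr_diag_mx mxtrace_mulC.
rewrite mulmxBr raddfB/=.
have := stationary_arith (Lam_max Lt) trWt trW kfD gW sq sqE
  (mxtrace_infoD Wt Lt) (mxtrace_infoD Wt Lam) (mxtrace_infoD Wt D)
  (mxtrace_quad_expand Lam D t sJ) crossE linE.
exact.
Qed.

(** [W] is the leading spectral projection at [Lam]. The equation is stationarity of the dual
    objective, and the last clause is Ky Fan's inequality, attained at [W]. *)
Theorem dual_certificate : exists W,
  [/\ projection_constraint r W, (mxinfo W + JP) *m Lam = diag_mx s,
      psdmxR (mxinfo W + JP) &
      forall W', relaxed_constraint r W' ->
        \tr (Lam^T *m (mxinfo W' + JP) *m Lam) <=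
        \tr (Lam^T *m (mxinfo W + JP) *m Lam)].
Proof.
have hA := mxcomb_gram_herm Lam.
have [W [cW trW gapW]] := top_projection hA r_range.
exists W; split; [exact: cW|..].
(* Choosing the residual itself as the direction [D] makes its squared norm nonpositive. *)
- apply/esym/eqP; rewrite -subr_eq0; apply/eqP/mxtrace_sqr_le0.
  exact: stationary_le0.
- have [[[_ pW] [sP pP]]] := (mxinfo_psd (let: And3 p _ _ := cW in p), JP_psd).
  split; first by rewrite linearD/= sP mxinfo_sym//; case: cW => -[].
  by move=> x; rewrite mulmxDr mulmxDl mxE addr_ge0.
- move=> W' cW'; rewrite -(mxtrace_infoD W' Lam) -(mxtrace_infoD W Lam).
  rewrite lerD2l ler_pM2l// trW; apply: ky_fan => //.
  by case/andP: r_range => -> /ltnW.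
Qed.

End DualCertificate.

(** * Integration against the posterior *)

Section TupleIntegrals.
Context {R : realType}.
Local Notation T := (measurableTypeR R).

Lemma integral_lebesgue_tupleS n (f : n.+1.-tuple T -> \bar R) :
  measurable_fun setT f -> (forall t, 0 <= f t)%E ->
  (\int[lebesgue_tuple R n.+1]_t f t =
   \int[@lebesgue_measure R]_x \int[lebesgue_tuple R n]_t f [tuple of x :: t])%E.
Proof.
move=> mf f0.
have -> : (\int[lebesgue_tuple R n.+1]_t f t =
    \int[pushforward (@lebesgue_measure R \x lebesgue_tuple R n)%E consp]_t f t)%E.
  by [].
rewrite ge0_integral_pushforward//; last exact: measurable_consp.
rewrite preimage_setT fubini_tonelli1//; last by move=> p; exact: f0.
by apply: measurableT_comp => //; exact: measurable_consp.
Qed.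

Lemma measurable_fun_integral_lebesgue_tuple n (f : n.+1.-tuple T -> \bar R) :
  measurable_fun setT f -> (forall t, 0 <= f t)%E ->
  measurable_fun setT
    (fun x : T => \int[lebesgue_tuple R n]_t f [tuple of x :: t])%E.
Proof.
move=> mf f0.
have := @measurable_fun_fubini_tonelli_F _ _ _ _ R (lebesgue_tuple R n) (f \o consp).
apply.
  by apply: measurableT_comp mf _; exact: measurable_consp.
by move=> p; exact: f0.
Qed.

Lemma measurable_lshift m n :
  measurable_fun setT (fun t : (m + n).-tuple T =>
    [tuple tnth t (lshift n i) | i < m] : m.-tuple T).
Proof.
apply/measurable_fun_tnthP => i.
apply: eq_measurable_fun (measurable_tnth (lshift n i)) => t _ /=.
by rewrite tnth_mktuple.
Qed.

Lemma measurable_rshift m n :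
  measurable_fun setT (fun t : (m + n).-tuple T =>
    [tuple tnth t (rshift m i) | i < n] : n.-tuple T).
Proof.
apply/measurable_fun_tnthP => i.
apply: eq_measurable_fun (measurable_tnth (rshift m i)) => t _ /=.
by rewrite tnth_mktuple.
Qed.

(** Induction on [m], one coordinate being peeled off by Tonelli each time. It separates the angles
    from the gains. *)
Lemma integral_lebesgue_tuple_split m n (F : m.-tuple T -> \bar R)
    (G : n.-tuple T -> \bar R) :
  measurable_fun setT F -> (forall t, 0 <= F t)%E ->
  measurable_fun setT G -> (forall t, 0 <= G t)%E ->
  (\int[lebesgue_tuple R (m + n)]_t
     (F [tuple tnth t (lshift n i) | i < m] *
      G [tuple tnth t (rshift m i) | i < n]) =
   \int[lebesgue_tuple R m]_t F t * \int[lebesgue_tuple R n]_t G t)%E.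
Proof.
move=> + + mG G0; elim: m F => [|m IH] F mF F0.
  under eq_integral => t _.
    rewrite (_ : [tuple tnth t (lshift n i) | i < 0] = [tuple]); last first.
      by apply/val_inj => /=; rewrite enum_ord0.
    rewrite (_ : [tuple tnth t (rshift 0 i) | i < n] = t); last first.
      by apply: eq_from_tnth => i; rewrite tnth_mktuple; congr tnth; exact/val_inj.
    over.
  rewrite ge0_integralZl//; congr (_ * _)%E.
  (* In dimension 0 the measure is the unit mass at the empty tuple. *)
  rewrite (_ : (lebesgue_tuple R 0 : set _ -> \bar R) = \d_[tuple])//.
  by rewrite integral_dirac// diracT mul1e.
pose H (t : (m.+1 + n).-tuple T) :=
  (F [tuple tnth t (lshift n i) | i < m.+1] *
   G [tuple tnth t (rshift m.+1 i) | i < n])%E.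
have mH : measurable_fun setT H.
  apply: emeasurable_funM.
    by apply: measurableT_comp mF _; exact: measurable_lshift.
  by apply: measurableT_comp mG _; exact: measurable_rshift.
have H0 t : (0 <= H t)%E by rewrite mule_ge0.
transitivity (\int[@lebesgue_measure R]_x
    (\int[lebesgue_tuple R m]_t F [tuple of x :: t] *
     \int[lebesgue_tuple R n]_t G t))%E.
  (* The sizes [m.+1 + n] and [(m + n).+1] are convertible, so the first coordinate can be split off
     without a cast. *)
  rewrite -[LHS]/(\int[lebesgue_tuple R (m + n).+1]_t H t)%E.
  rewrite integral_lebesgue_tupleS//; apply: eq_integral => x _.
  rewrite -IH//; last first.
    by apply: measurableT_comp mF _; apply: measurable_cons => //; exact: measurable_cst.
  apply: eq_integral => t _; rewrite /H; congr (F _ * G _)%E.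
    apply: eq_from_tnth => i; rewrite tnth_mktuple.
    case: (unliftP ord0 i) => [j ->|->]; last by rewrite !(tnth_nth x).
    by rewrite tnthS tnth_mktuple !(tnth_nth x).
  apply: eq_from_tnth => i; rewrite !tnth_mktuple.
  by rewrite !(tnth_nth x).
rewrite integral_lebesgue_tupleS// ge0_integralZr//.
- exact: measurable_fun_integral_lebesgue_tuple.
- by move=> x _; apply: integral_ge0.
- exact: integral_ge0.
Qed.

Lemma integral_lebesgue_tuple_prod n (g : T -> R) :
  measurable_fun setT g -> (forall x, 0 <= g x) ->
  (\int[@lebesgue_measure R]_x (g x)%:E < +oo)%E ->
  (\int[lebesgue_tuple R n]_t (\prod_(i < n) g (tnth t i))%:E < +oo)%E.
Proof.
move=> mg g0 goo; elim: n => [|n IH].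
  rewrite (_ : (lebesgue_tuple R 0 : set _ -> \bar R) = \d_[tuple])//.
  under eq_integral do rewrite big_ord0.
  by rewrite integral_dirac// diracT mul1e ltry.
rewrite integral_lebesgue_tupleS//; last 2 first.
- apply/measurable_EFinP; apply: measurable_prod => i _.
  by apply: measurableT_comp mg _; exact: measurable_tnth.
- by move=> t; rewrite lee_fin prodr_ge0.
have mp : measurable_fun setT (fun t : n.-tuple T => (\prod_(i < n) g (tnth t i))%:E).
  apply/measurable_EFinP; apply: measurable_prod => i _.
  by apply: measurableT_comp mg _; exact: measurable_tnth.
have p0 (t : n.-tuple T) : (0 <= (\prod_(i < n) g (tnth t i))%:E)%E.
  by rewrite lee_fin prodr_ge0.
have E (x : T) (t : n.-tuple T) : (\prod_(i < n.+1) g (tnth [tuple of x :: t] i))%:E =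
    ((g x)%:E * (\prod_(i < n) g (tnth t i))%:E)%E.
  by rewrite big_ord_recl tnth0 EFinM; under eq_bigr do rewrite tnthS.
under eq_integral => x _.
  under eq_integral do rewrite E.
  rewrite ge0_integralZl//; last by rewrite lee_fin.
  over.
rewrite ge0_integralZr//; last 3 first.
- exact/measurable_EFinP.
- by move=> x _; rewrite lee_fin.
- exact: integral_ge0.
apply: lte_mul_pinfty => //; first by apply: integral_ge0 => x _; rewrite lee_fin.
by rewrite ge0_fin_numE//; apply: integral_ge0 => x _; rewrite lee_fin.
Qed.

(** The integrand is a constant multiple of the standard normal density. *)
Lemma integrable_gauss :
  (\int[@lebesgue_measure R]_x (expR (- (x ^+ 2 / 2)))%:E < +oo)%E.
Proof.
pose c := normal_peak (1 : R).
have c0 : 0 < c by exact: normal_peak_gt0.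
have E (x : R) : expR (- (x ^+ 2 / 2)) = c^-1 * normal_pdf 0 1 x.
  rewrite normal_pdfE ?oner_neq0//= -/c mulKf ?gt_eqF//.
  by rewrite /normal_fun subr0 expr1n mulNr.
under eq_integral do rewrite E EFinM.
rewrite ge0_integralZl//.
- by rewrite integral_normal_pdf mule1 ltry.
- by apply/measurable_EFinP; exact: measurable_normal_pdf.
- by move=> x _; rewrite lee_fin normal_pdf_ge0.
- by rewrite lee_fin invr_ge0 ltW.
Qed.

End TupleIntegrals.

(** * Directional derivatives by restriction to a line *)

Section DirectionalDerivatives.
Context {R : realType} {V : normedModType R}.

(** The two difference quotients coincide; one-variable rules, such as the chain rule, thereby
    become available for directional derivatives. *)
Lemma is_derive_line (x v : V) (f : V -> R) (df : R) :
  is_derive x v f df <-> is_derive (0 : R) (1 : R) (fun h : R => f (h *: v + x)) df.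
Proof.
have E : (fun h : R => h^-1 *: ((f \o shift x) (h *: v) - f x)) =
    (fun h : R => h^-1 *: (((fun h : R => f (h *: v + x)) \o shift 0) (h *: 1) -
      f ((0 : R) *: v + x))).
  by apply/funext => h /=; rewrite addr0 scale0r add0r [h *: 1]mulr1.
by split => -[]; rewrite /derivable /derive => d1 d2; split;
  rewrite /derivable /derive ?E// -E.
Qed.

Lemma is_derive_comp1 (x v : V) (f : V -> R) (g : R -> R) (df dg : R) :
  is_derive x v f df -> is_derive (f x) 1 g dg ->
  is_derive x v (fun y => g (f y)) (df * dg).
Proof.
move=> /is_derive_line Df Dg; apply/is_derive_line.
have Dg' : is_derive ((fun h : R => f (h *: v + x)) 0) 1 g dg.
  by rewrite scale0r add0r.
by have := is_derive1_comp Dg' Df; rewrite mulrC.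
Qed.

End DirectionalDerivatives.

(** * Functions of controlled growth in the gains *)

Section GrowthClasses.
Context {R : realType} {L : nat}.
Local Notation C := R[i].
Local Notation param := 'rV[R]_(pdim L).
Local Notation T := ((pdim L).-tuple (measurableTypeR R)).

(* The square of this weight times the prior density of the gains is still a
   Gaussian: that is the room needed to integrate products of two derivatives
   of the response. *)
Definition weight (th : param) : R :=
  expR (\sum_(j < L + L) th 0 (rshift L j) ^+ 2 / 4).

Lemma weight_ge1 th : 1 <= weight th.
Proof.
rewrite -expR0 ler_expR; apply: sumr_ge0 => j _.
by rewrite mulr_ge0// sqr_ge0.
Qed.

(** The exponent [n] is a degree that adds up under products. The weight depends on the gains alone,
    so a tame function is bounded in the angles. Measurability is asked after [param_of_tuple]
    because the integrals run over tuples. *)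
Definition tame n (f : param -> R) : Prop :=
  measurable_fun setT (fun t : T => f (param_of_tuple t)) /\
  exists c, forall th, `|f th| <= c * weight th ^+ n.

Definition dtame n (f : param -> R) : Prop :=
  tame n f /\ forall i, exists2 f', (forall th, is_derive th (Defs.basis i) f (f' th)) &
    tame n f'.

Lemma measurable_coord i :
  measurable_fun setT (fun t : T => (param_of_tuple t : param) 0 i).
Proof.
apply: eq_measurable_fun (measurable_tnth i) => t _.
by rewrite /param_of_tuple mxE.
Qed.

Lemma tame_cst n c : tame n (fun=> c).
Proof.
split; first exact: measurable_cst.
by exists `|c| => th; rewrite ler_peMr// exprn_ege1// weight_ge1.
Qed.

Lemma tameD n f g : tame n f -> tame n g -> tame n (fun th => f th + g th).
Proof.
move=> [mf [c cf]] [mg [d dg]]; split; first exact: measurable_funD.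
exists (c + d) => th; rewrite mulrDl (le_trans (ler_normD _ _))//.
by rewrite lerD.
Qed.

Lemma tameN n f : tame n f -> tame n (fun th => - f th).
Proof.
move=> [mf [c cf]]; split; first exact: measurable_funN.
by exists c => th; rewrite normrN.
Qed.

Lemma tameM m n f g : tame m f -> tame n g ->
  tame (m + n) (fun th => f th * g th).
Proof.
move=> [mf [c cf]] [mg [d dg]]; split; first exact: measurable_funM.
by exists (c * d) => th; rewrite normrM exprD mulrACA ler_pM.
Qed.

Lemma dtame_cst n c : dtame n (fun=> c).
Proof.
split; first exact: tame_cst.
by move=> i; exists (fun=> 0); [move=> th; exact: is_derive_cst | exact: tame_cst].
Qed.

Lemma dtameD n f g : dtame n f -> dtame n g -> dtame n (fun th => f th + g th).
Proof.
move=> [tf df] [tg dg]; split; first exact: tameD.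
move=> i; have [f' Df tf'] := df i; have [g' Dg tg'] := dg i.
exists (fun th => f' th + g' th); last exact: tameD.
by move=> th; exact: (is_deriveD (Df th) (Dg th)).
Qed.

Lemma dtameN n f : dtame n f -> dtame n (fun th => - f th).
Proof.
move=> [tf df]; split; first exact: tameN.
move=> i; have [f' Df tf'] := df i.
exists (fun th => - f' th); last exact: tameN.
by move=> th; exact: (is_deriveN (Df th)).
Qed.

Lemma dtameM m n f g : dtame m f -> dtame n g ->
  dtame (m + n) (fun th => f th * g th).
Proof.
move=> [tf df] [tg dg]; split; first exact: tameM.
move=> i; have [f' Df tf'] := df i; have [g' Dg tg'] := dg i.
exists (fun th => f th * g' th + g th * f' th).
  by move=> th; exact: (is_deriveM (Df th) (Dg th)).
by apply: tameD; [exact: tameM|rewrite addnC; exact: tameM].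
Qed.

Lemma is_derive_coord j (th v : param) :
  is_derive th v (fun x : param => x 0 j) (v 0 j).
Proof.
apply/is_derive_line.
have -> : (fun h : R => (h *: v + th) 0 j) = (id * cst (v 0 j) + cst (th 0 j)).
  by apply/funext => h; rewrite !mxE.
apply: is_derive_eq; rewrite /= scaler0 add0r addr0.
exact: mulr1.
Qed.

Lemma dtame_gain j : dtame 1 (fun th => th 0 (rshift L j)).
Proof.
split; last first.
  move=> i; exists (fun=> Defs.basis i 0 (rshift L j)); last exact: tame_cst.
  by move=> th; exact: is_derive_coord.
split; first exact: measurable_coord.
exists 1 => th; rewrite mul1r expr1; set x := th 0 _.
(* Expanding the square of [|x| / 2 - 1] gives [|x| <= 1 + x ^+ 2 / 4], which is at most the
   exponential of [x ^+ 2 / 4]. *)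
apply: le_trans (_ : 1 + x ^+ 2 / 4 <= _).
  have := sqr_ge0 (`|x| / 2 - 1); have := real_normK (num_real x); nra.
apply: le_trans (expR_ge1Dx _) _; rewrite ler_expR.
rewrite (bigD1 j)//= lerDl; apply: sumr_ge0 => l _.
by rewrite mulr_ge0// sqr_ge0.
Qed.

(** No bound is put on [f] itself: an angle is unbounded and not tame, yet its sine and cosine are,
    because the chain rule only involves the derivatives of [f]. *)
Definition has_bounded_derivatives (f : param -> R) : Prop :=
  measurable_fun setT (fun t : T => f (param_of_tuple t)) /\
  forall i, exists2 f', (forall th, is_derive th (Defs.basis i) f (f' th)) & tame 0 f'.

Lemma dtame_trig f (g g' : R -> R) : has_bounded_derivatives f ->
  (forall x : R, is_derive x (1 : R) g (g' x)) ->
  measurable_fun setT g -> measurable_fun setT g' ->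
  (forall x, `|g x| <= 1) -> (forall x, `|g' x| <= 1) ->
  dtame 0 (fun th => g (f th)).
Proof.
move=> [mf df] Dg mg mg' g1 g'1; split.
  by split; [exact: measurableT_comp mg mf | exists 1 => th; rewrite mulr1].
move=> i; have [f' Df [mf' [c cf']]] := df i.
exists (fun th => f' th * g' (f th)).
  by move=> th; exact: is_derive_comp1.
rewrite -[0%N]/(0 + 0)%N; apply: tameM; first by split=> //; exists c.
by split; [exact: measurableT_comp mg' mf | exists 1 => th; rewrite mulr1].
Qed.

Lemma dtame_cos f : has_bounded_derivatives f -> dtame 0 (fun th => cos (f th)).
Proof.
move=> bf; apply: (dtame_trig bf (g' := fun x => - sin x)).
- exact: continuous_measurable_fun (@continuous_cos R).
- by apply: measurable_funN; exact: continuous_measurable_fun (@continuous_sin R).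
- by move=> x; rewrite ler_norml cos_geN1 cos_le1.
- by move=> x; rewrite normrN ler_norml sin_geN1 sin_le1.
Qed.

Lemma dtame_sin f : has_bounded_derivatives f -> dtame 0 (fun th => sin (f th)).
Proof.
move=> bf; apply: (dtame_trig bf (g' := @cos R)).
- exact: continuous_measurable_fun (@continuous_sin R).
- exact: continuous_measurable_fun (@continuous_cos R).
- by move=> x; rewrite ler_norml sin_geN1 sin_le1.
- by move=> x; rewrite ler_norml cos_geN1 cos_le1.
Qed.

Lemma has_bounded_derivatives_angle l :
  has_bounded_derivatives (fun th => angle th l).
Proof.
split; first exact: measurable_coord.
move=> i; exists (fun=> Defs.basis i 0 (lshift (L + L) l)); last exact: tame_cst.
by move=> th; exact: is_derive_coord.
Qed.

Lemma has_bounded_derivatives_dtame f : dtame 0 f -> has_bounded_derivatives f.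
Proof. by move=> [[mf _] df]. Qed.

End GrowthClasses.

(** * Complex and matrix-valued functions over a graded class *)

Section ComplexClasses.
Context {R : realType} {X : Type}.
Local Notation C := R[i].
Variable P : nat -> (X -> R) -> Prop.

(** The closure properties common to [tame] and [dtame], so that the passage to complex matrices is
    carried out once for both. *)
Record graded_class : Prop := GradedClass {
  graded_cst : forall n c, P n (fun=> c);
  gradedD : forall n f g, P n f -> P n g -> P n (fun x => f x + g x);
  gradedN : forall n f, P n f -> P n (fun x => - f x);
  gradedM : forall m n f g, P m f -> P n g -> P (m + n) (fun x => f x * g x) }.

Definition gradedC n (F : X -> C) : Prop :=
  P n (fun x => complex.Re (F x)) /\ P n (fun x => complex.Im (F x)).

Definition graded_mx n p q (F : X -> 'M[C]_(p, q)) : Prop :=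
  forall a b, gradedC n (fun x => F x a b).

Hypothesis gP : graded_class.

Lemma gradedC_cst n c : gradedC n (fun=> c).
Proof. by split; exact: graded_cst. Qed.

Lemma gradedCD n F G : gradedC n F -> gradedC n G ->
  gradedC n (fun x => F x + G x).
Proof.
have ReE x : complex.Re (F x + G x) = complex.Re (F x) + complex.Re (G x).
  by case: (F x) (G x) => [? ?] [? ?].
have ImE x : complex.Im (F x + G x) = complex.Im (F x) + complex.Im (G x).
  by case: (F x) (G x) => [? ?] [? ?].
move=> [f1 f2] [g1 g2]; split.
  by rewrite (funext ReE); exact: gradedD.
by rewrite (funext ImE); exact: gradedD.
Qed.

Lemma gradedCM m n F G : gradedC m F -> gradedC n G ->
  gradedC (m + n) (fun x => F x * G x).
Proof.
have ReE x : complex.Re (F x * G x) = complex.Re (F x) * complex.Re (G x) -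
    complex.Im (F x) * complex.Im (G x) by case: (F x) (G x) => [? ?] [? ?].
have ImE x : complex.Im (F x * G x) = complex.Re (F x) * complex.Im (G x) +
    complex.Im (F x) * complex.Re (G x) by case: (F x) (G x) => [? ?] [? ?].
move=> [f1 f2] [g1 g2]; split.
  rewrite (funext ReE); apply: gradedD => //; first exact: gradedM.
  by apply: gradedN => //; exact: gradedM.
by rewrite (funext ImE); apply: gradedD => //; exact: gradedM.
Qed.

Lemma gradedC_conj n F : gradedC n F -> gradedC n (fun x => Num.conj (F x)).
Proof.
have ReE x : complex.Re (Num.conj (F x)) = complex.Re (F x) by case: (F x).
have ImE x : complex.Im (Num.conj (F x)) = - complex.Im (F x) by case: (F x).
move=> [f1 f2]; split; first by rewrite (funext ReE).
by rewrite (funext ImE); exact: gradedN.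
Qed.

Lemma gradedC_sum n I (r : seq I) (F : I -> X -> C) :
  (forall i, gradedC n (F i)) -> gradedC n (fun x => \sum_(i <- r) F i x).
Proof.
move=> gF; elim: r => [|i r IH].
  by under [X in gradedC _ X]eq_fun do rewrite big_nil; exact: gradedC_cst.
under [X in gradedC _ X]eq_fun do rewrite big_cons.
exact: gradedCD.
Qed.

Lemma graded_mx_cst n p q (A : 'M[C]_(p, q)) : graded_mx n (fun=> A).
Proof. by move=> a b; exact: gradedC_cst. Qed.

Lemma graded_mxM m n p q s (F : X -> 'M[C]_(p, q)) (G : X -> 'M[C]_(q, s)) :
  graded_mx m F -> graded_mx n G -> graded_mx (m + n) (fun x => F x *m G x).
Proof.
move=> gF gG a b; under [X in gradedC _ X]eq_fun do rewrite mxE.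
by apply: gradedC_sum => c; exact: gradedCM.
Qed.

Lemma graded_mxD n p q (F G : X -> 'M[C]_(p, q)) :
  graded_mx n F -> graded_mx n G -> graded_mx n (fun x => F x + G x).
Proof.
by move=> gF gG a b; under [X in gradedC _ X]eq_fun do rewrite mxE; exact: gradedCD.
Qed.

Lemma graded_mx_adj n p q (F : X -> 'M[C]_(p, q)) :
  graded_mx n F -> graded_mx n (fun x => (F x)^t* ).
Proof.
move=> gF a b; under [X in gradedC _ X]eq_fun do rewrite 2!mxE.
exact: gradedC_conj.
Qed.

Lemma graded_mx_tr n p (F : X -> 'M[C]_p) :
  graded_mx n F -> gradedC n (fun x => \tr (F x)).
Proof. by move=> gF; apply: gradedC_sum => a; exact: gF. Qed.

End ComplexClasses.

(** * Growth of the response and of its derivatives *)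

Section ResponseGrowth.
Context {R : realType} {L NT NR : nat}.
Local Notation C := R[i].
Local Notation param := 'rV[R]_(pdim L).

Lemma tame_graded : graded_class (@tame R L).
Proof. by split; [exact: tame_cst|exact: tameD|exact: tameN|exact: tameM]. Qed.

Lemma dtame_graded : graded_class (@dtame R L).
Proof. by split; [exact: dtame_cst|exact: dtameD|exact: dtameN|exact: dtameM]. Qed.

Lemma steering_graded N l : graded_mx (@dtame R L) 0
  (fun th => steering N (angle th l)).
Proof.
move=> a b; have B : has_bounded_derivatives
    (fun th : param => a%:R * pi * sin (angle th l)).
  apply: has_bounded_derivatives_dtame; rewrite -[0%N]/(0 + 0)%N.
  apply: dtameM; first exact: dtame_cst.
  exact/dtame_sin/has_bounded_derivatives_angle.
split.
  rewrite (_ : (fun _ => _) = (fun th => cos (a%:R * pi * sin (angle th l)))).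
    exact: dtame_cos.
  by apply/funext => th; rewrite mxE.
rewrite (_ : (fun _ => _) = (fun th => sin (a%:R * pi * sin (angle th l)))).
  exact: dtame_sin.
by apply/funext => th; rewrite mxE.
Qed.

(** Each summand is a gain, of degree 1, times two steering vectors of degree 0. *)
Lemma response_graded :
  graded_mx (@dtame R L) 1 (fun th => response th : 'M[C]_(NR, NT)).
Proof.
move=> a b; rewrite /response.
under [X in gradedC _ _ X]eq_fun do rewrite summxE.
apply: (gradedC_sum dtame_graded) => l.
under [X in gradedC _ _ X]eq_fun do rewrite mxE.
rewrite -[1%N]/(1 + (0 + 0))%N; apply: (gradedCM dtame_graded).
  by split; exact: dtame_gain.
apply: (graded_mxM dtame_graded); first exact: steering_graded.
by apply: (graded_mx_adj dtame_graded); exact: steering_graded.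
Qed.

Lemma dtame_derive n f i : @dtame R L n f -> tame n ('D_(Defs.basis i) f).
Proof.
move=> [_ /(_ i)[f' Df tf']].
rewrite (_ : 'D_(Defs.basis i) f = f')//.
by apply/funext => th; rewrite derive_val.
Qed.

(** Degree 1 for one derivative means degree 2 for a product of two, exactly the degree that
    [integrable_tame] accepts. *)
Lemma dresponse_graded i :
  graded_mx (@tame R L) 1 (fun th => dresponse i th : 'M[C]_(NR, NT)).
Proof.
move=> a b; have [dRe dIm] := response_graded a b; split.
  rewrite (_ : (fun _ => _) = 'D_(Defs.basis i) (fun x => complex.Re (response x a b))).
    exact: dtame_derive.
  by apply/funext => th; rewrite mxE.
rewrite (_ : (fun _ => _) = 'D_(Defs.basis i) (fun x => complex.Im (response x a b))).
  exact: dtame_derive.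
by apply/funext => th; rewrite mxE.
Qed.

Lemma response_tame :
  graded_mx (@tame R L) 1 (fun th => response th : 'M[C]_(NR, NT)).
Proof. by move=> a b; have [[? _] [? _]] := response_graded a b. Qed.

End ResponseGrowth.

(** * Bounds and measurability for the complex Gaussian density *)

Section GaussianLikelihood.
Context {R : realType}.
Local Notation C := R[i].

Lemma psdmxC_gram m n (W : 'M[C]_(m, n)) : psdmxC (W^t* *m W).
Proof.
rewrite -(mulmx1 (W^t* )); apply: psdmxC_congr; apply: orthoprojmx_psd.
by split; [exact: adjmx1 | rewrite mulmx1].
Qed.

Lemma psdmxC_inv n (S : 'M[C]_n) : psdmxC S -> psdmxC (invmx S).
Proof.
(* For singular [S], [invmx S] is [S] itself by convention; otherwise the inverse is a congruence of
   [S]. *)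
move=> pS; have [uS|/invmx_out ->//] := boolP (S \in unitmx).
rewrite -(invmx_gram (let: conj h _ := pS in h) uS); exact: psdmxC_congr.
Qed.

Lemma psdmxC_det_ge0 n (S : 'M[C]_n) : psdmxC S -> 0 <= complex.Re (\det S).
Proof.
move=> pS; have [U uU SE] := hermitian_sorted_spectral (let: conj h _ := pS in h).
pose D := diag_mx (\row_i (eigval S i.+1)%:C) : 'M[C]_n.
have -> : \det S = \det D.
  by apply: etrans (congr1 determinant SE) _; exact: det_unitary_conj.
have pD : psdmxC D.
  have -> : D = U^t*^t* *m S *m U^t*.
    rewrite trmxCK; apply/esym.
    apply: etrans (congr1 (fun M => U *m M *m U^t* ) SE) _; exact: unitarymx_conjK.
  exact: psdmxC_congr.
rewrite det_diag; under eq_bigr do rewrite mxE.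
rewrite -rmorph_prod /= prodr_ge0// => i _.
by have := psdmxC_diag_ge0 i pD; rewrite !mxE eqxx.
Qed.

(** The exponent is minus the trace of a semidefinite matrix, so the exponential is at most 1 and
    the normalizing factor is a bound. *)
Lemma cgauss_pdf_bounded m n (S : 'M[C]_m) : psdmxC S ->
  exists c, forall X : 'M[C]_(m, n), 0 <= cgauss_pdf S X <= c.
Proof.
move=> pS; exists ((pi ^+ (m * n))^-1 * (complex.Re (\det S) ^+ n)^-1) => X.
have c0 : 0 <= (pi ^+ (m * n))^-1 * (complex.Re (\det S) ^+ n)^-1 :> R.
  by rewrite mulr_ge0// invr_ge0 exprn_ge0// ?pi_ge0// psdmxC_det_ge0.
rewrite /cgauss_pdf mulr_ge0 ?expR_ge0//= -[leRHS]mulr1 ler_wpM2l//.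
rewrite -expR0 ler_expR oppr_le0.
have := psdmxC_congr X (psdmxC_inv pS).
set M := X^t* *m _ *m X => pM; rewrite /mxtrace Re_sum; apply: sumr_ge0 => i _.
exact: psdmxC_diag_ge0.
Qed.

Lemma measurable_cgauss_pdf L m n p (S : 'M[C]_m) (X : 'rV[R]_(pdim L) -> 'M[C]_(m, n)) :
  graded_mx (@tame R L) p X ->
  measurable_fun setT (fun t : (pdim L).-tuple (measurableTypeR R) =>
    cgauss_pdf S (X (param_of_tuple t))).
Proof.
move=> gX; have g := @tame_graded R L.
have [[mq _] _] : gradedC (@tame R L) (p + 0 + p)
    (fun th => \tr ((X th)^t* *m invmx S *m X th)).
  apply: (graded_mx_tr g); apply: (graded_mxM g) => //; apply: (graded_mxM g).
    exact: (graded_mx_adj g).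
  exact: (graded_mx_cst g).
apply: measurable_funM; first exact: measurable_cst.
exact: measurableT_comp (@measurable_expR R) (measurable_funN mq).
Qed.

End GaussianLikelihood.

(** * The posterior density and integrability against it *)

Section Posterior.
Context {R : realType} {L NT NR MT MR k : nat}.
Local Notation C := R[i].
Local Notation param := 'rV[R]_(pdim L).
Local Notation T := ((pdim L).-tuple (measurableTypeR R)).
Variable fphi : L.-tuple (measurableTypeR R) -> R.
Variable Vpol : seq 'M[C]_(MR, MT) -> 'M[C]_(NT, MT).
Variable Wpol : seq 'M[C]_(MR, MT) -> 'M[C]_(NR, MR).
Variable Y : k.-1.-tuple 'M[C]_(MR, MT).
Hypothesis fphi_meas : measurable_fun setT fphi.
Hypothesis fphi_ge0 : forall t, 0 <= fphi t.
Hypothesis fphi_int : (\int[lebesgue_tuple R L]_t (fphi t)%:E < +oo)%E.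

Local Notation lik := (likelihood Vpol Wpol Y).
Local Notation post := (posterior fphi Vpol Wpol Y).

Lemma likelihood_bounded : exists c, forall th : param, 0 <= lik th <= c.
Proof.
pose W l := Wpol (take l Y).
have /choice[c cP] : forall l : 'I_k.-1, exists c, forall X : 'M[C]_(MR, MT),
    0 <= cgauss_pdf ((W l)^t* *m W l) X <= c.
  by move=> l; exact/cgauss_pdf_bounded/psdmxC_gram.
exists (\prod_l c l) => th; apply/andP; split.
  by apply: prodr_ge0 => l _; apply: (proj1 (andP (cP l _))).
by apply: ler_prod => l _; exact: cP.
Qed.

Lemma measurable_likelihood :
  measurable_fun setT (fun t : T => lik (param_of_tuple t)).
Proof.
apply: measurable_prod => l _; have g := @tame_graded R L.
apply: (measurable_cgauss_pdf (p := 1) _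
  (X := fun th => tnth Y l - (Wpol (take l Y))^t* *m response th *m Vpol (take l Y))).
(* The difference is put in the form of sums and products with constants, the operations under which
   graded classes are closed. *)
under eq_fun do rewrite -mulNmx -mulmxN.
apply: (graded_mxD g); first exact: (graded_mx_cst g).
rewrite -[1%N]/(0 + 1 + 0)%N; apply: (graded_mxM g); last exact: (graded_mx_cst g).
rewrite -[(0 + 1)%N]/(0 + (0 + 1))%N; apply: (graded_mxM g).
  exact: (graded_mx_cst g).
under eq_fun do rewrite -scaleN1r -mul_scalar_mx.
by apply: (graded_mxM g); [exact: (graded_mx_cst g) | exact: response_tame].
Qed.

(** Real and imaginary parts of all gains are gathered into one Gaussian over [L + L] real
    coordinates, matching the sum in [weight]. *)
Lemma prior_gauss (th : param) : prior fphi th =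
  fphi [tuple angle th i | i < L] *
  (pi^-1 ^+ L * expR (- \sum_(j < L + L) th 0 (rshift L j) ^+ 2)).
Proof.
rewrite /prior big_split/= prodr_const card_ord -expR_sum big_split_ord/=.
rewrite -big_split/= -sumrN; congr (_ * (_ * expR _)).
by apply: eq_bigr => i _; rewrite /gain /=; ring.
Qed.

Lemma measurable_prior :
  measurable_fun setT (fun t : T => prior fphi (param_of_tuple t)).
Proof.
under eq_fun do rewrite prior_gauss.
apply: measurable_funM.
  apply: (measurableT_comp (g := fun t : T => [tuple angle (param_of_tuple t) i | i < L])
    fphi_meas _).
  apply/measurable_fun_tnthP => i.
  apply: eq_measurable_fun (measurable_coord (lshift (L + L) i)) => t _ /=.
  by rewrite tnth_mktuple.
apply: measurable_funM; first exact: measurable_cst.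
apply: measurableT_comp (@measurable_expR R) _; apply: measurable_funN.
apply: measurable_sum => j; apply: measurable_funX; exact: measurable_coord.
Qed.

Lemma posterior_ge0 (th : param) : 0 <= post th.
Proof.
have d0 (x : param) : 0 <= prior fphi x * lik x.
  have [c /(_ x)/andP[l0 _]] := likelihood_bounded.
  rewrite mulr_ge0// prior_gauss !mulr_ge0 ?exprn_ge0 ?invr_ge0 ?pi_ge0 ?expR_ge0//.
rewrite /posterior mulr_ge0// invr_ge0; exact: Rintegral_ge0.
Qed.

Lemma measurable_posterior :
  measurable_fun setT (fun t : T => post (param_of_tuple t)).
Proof.
apply: measurable_funM; last exact: measurable_cst.
by apply: measurable_funM; [exact: measurable_prior|exact: measurable_likelihood].
Qed.

Lemma dominating_integrable :
  (\int[lebesgue_tuple R (pdim L)]_t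
    (fphi [tuple tnth t (lshift (L + L) i) | i < L] *
     \prod_(j < L + L) expR (- (tnth t (rshift L j) ^+ 2 / 2)))%:E < +oo)%E.
Proof.
have mg : measurable_fun setT (fun x : measurableTypeR R => expR (- (x ^+ 2 / 2))).
  apply: measurableT_comp (@measurable_expR R) _; apply: measurable_funN.
  by apply: measurable_funM; [exact: measurable_funX|exact: measurable_cst].
pose F t := (fphi t)%:E.
pose G (t : (L + L).-tuple (measurableTypeR R)) :=
  (\prod_(j < L + L) expR (- (tnth t j ^+ 2 / 2)))%:E.
have F0 t : (0 <= F t)%E by rewrite lee_fin.
have G0 t : (0 <= G t)%E by rewrite lee_fin prodr_ge0// => j _; exact: expR_ge0.
have mF : measurable_fun setT F by exact/measurable_EFinP.
have mG : measurable_fun setT G.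
  apply/measurable_EFinP; apply: measurable_prod => j _.
  by apply: measurableT_comp mg _; exact: measurable_tnth.
under eq_integral => t _.
  rewrite EFinM -/(F _).
  rewrite (_ : (\prod_(_ < _) _)%:E = G [tuple tnth t (rshift L j) | j < L + L]);
    last first.
    by rewrite /G; congr (_%:E); apply: eq_bigr => j _; rewrite tnth_mktuple.
  over.
rewrite integral_lebesgue_tuple_split//.
have Goo : (\int[lebesgue_tuple R (L + L)]_t G t < +oo)%E.
  apply: (@integral_lebesgue_tuple_prod R _ (fun x => expR (- (x ^+ 2 / 2)))) => //.
  exact: integrable_gauss.
apply: lte_mul_pinfty => //; first exact: integral_ge0.
by rewrite ge0_fin_numE//; exact: integral_ge0.
Qed.

(** The squared weight costs half of the exponent of the Gaussian prior. What remains is dominated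
    by a constant times [fphi] on the angles and [expR (- (x ^+ 2 / 2))] on each gain coordinate. *)
Lemma integrable_tame f : tame 2 f ->
  (lebesgue_tuple R (pdim L)).-integrable setT
    (EFin \o (fun t : T => f (param_of_tuple t) * post (param_of_tuple t))).
Proof.
move=> [mf [c cf]]; have [d dP] := likelihood_bounded.
set Z := \int[lebesgue_tuple R (pdim L)]_t
  (prior fphi (param_of_tuple t) * lik (param_of_tuple t)).
pose D (t : T) := fphi [tuple tnth t (lshift (L + L) i) | i < L] *
  \prod_(j < L + L) expR (- (tnth t (rshift L j) ^+ 2 / 2)).
have D0 t : 0 <= D t.
  by rewrite mulr_ge0// prodr_ge0// => j _; exact: expR_ge0.
have mD : measurable_fun setT D.
  apply: measurable_funM.
    by apply: measurableT_comp fphi_meas _; exact: measurable_lshift.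
  apply: measurable_prod => j _; apply: measurableT_comp (@measurable_expR R) _.
  apply: measurable_funN; apply: measurable_funM; last exact: measurable_cst.
  by apply: measurable_funX; exact: measurable_tnth.
have iD : (lebesgue_tuple R (pdim L)).-integrable setT (EFin \o D).
  apply/integrableP; split; first exact/measurable_EFinP.
  under eq_integral do rewrite /= ger0_norm//.
  exact: dominating_integrable.
(* The factors come from the growth of [f], the prior of the gains, the bound on the likelihood and
   the normalization. The absolute values spare any sign information on [c] and [Z]. *)
pose K := `|c| * pi^-1 ^+ L * d * `|Z^-1|.
have K0 : 0 <= K.
  have /andP[l0 ld] := dP 0.
  have d0 : 0 <= d by exact: le_trans ld.
  have p0 : 0 <= `|c| * pi^-1 ^+ L by rewrite mulr_ge0// exprn_ge0// invr_ge0 pi_ge0.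
  by apply: mulr_ge0 => //; exact: mulr_ge0.
apply: (@le_integrable _ _ _ _ _ _ _ (EFin \o (fun t => K * D t))) => //.
- apply/measurable_EFinP; apply: measurable_funM => //; exact: measurable_posterior.
- move=> t _; rewrite /= lee_fin [leRHS]ger0_norm; last first.
    exact: mulr_ge0.
  set th := param_of_tuple t.
  have DE : D t = fphi [tuple angle th i | i < L] *
      (expR (- \sum_(j < L + L) th 0 (rshift L j) ^+ 2) * weight th ^+ 2).
    rewrite /D; congr (fphi _ * _).
      by apply: eq_from_tnth => i; rewrite !tnth_mktuple /angle mxE.
    rewrite -expR_sum /weight -expRM_natl -expRD; congr expR.
    rewrite -sumrN mulr_sumr -big_split/=; apply: eq_bigr => j _.
    by rewrite mxE; field.
  rewrite /posterior normrM prior_gauss -/Z DE /K.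
  have /andP[l0 ld] := dP th.
  rewrite !normrM (ger0_norm l0) (ger0_norm (fphi_ge0 _)).
  rewrite (ger0_norm (expR_ge0 _)) (@ger0_norm _ (pi^-1 ^+ L)); last first.
    by rewrite exprn_ge0// invr_ge0 pi_ge0.
  have fc : `|f th| <= `|c| * weight th ^+ 2.
    by rewrite (le_trans (cf th))// ler_wpM2r ?exprn_ge0 ?expR_ge0// ler_norm.
  set A := fphi _; set B := pi^-1 ^+ L; set E := expR _; set w := weight th ^+ 2.
  have A0 : 0 <= A by exact: fphi_ge0.
  have B0 : 0 <= B by rewrite exprn_ge0// invr_ge0 pi_ge0.
  have E0 : 0 <= E by exact: expR_ge0.
  rewrite (_ : `|c| * B * d * `|Z^-1| * (A * (E * w)) =
    (`|c| * w) * (A * (B * E) * d * `|Z^-1|)); last by ring.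
  apply: ler_pM => //; first by rewrite !mulr_ge0.
  by rewrite ler_wpM2r// ler_wpM2l// !mulr_ge0.
- by apply: eq_integrable (integrableZl measurableT K iD) => // t _ /=; rewrite EFinM.
Qed.

End Posterior.

(** * Linearity of the posterior expectation and the mean correlations *)

Section PosteriorExpectation.
Context {R : realType} {L NT NR MT MR k : nat}.
Local Notation C := R[i].
Local Notation param := 'rV[R]_(pdim L).
Variable fphi : L.-tuple (measurableTypeR R) -> R.
Variable Vpol : seq 'M[C]_(MR, MT) -> 'M[C]_(NT, MT).
Variable Wpol : seq 'M[C]_(MR, MT) -> 'M[C]_(NR, MR).
Variable Y : k.-1.-tuple 'M[C]_(MR, MT).
Hypothesis fphi_meas : measurable_fun setT fphi.
Hypothesis fphi_ge0 : forall t, 0 <= fphi t.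
Hypothesis fphi_int : (\int[lebesgue_tuple R L]_t (fphi t)%:E < +oo)%E.

Local Notation Ep := (Epost fphi Vpol Wpol Y).
Local Notation EpM := (EpostM fphi Vpol Wpol Y).
Local Notation tame2C := (gradedC (@tame R L) 2).
Local Notation tame2 := (graded_mx (@tame R L) 2).

Let tg := @tame_graded R L.

Lemma EpostD (f g : param -> R) : tame 2 f -> tame 2 g ->
  Ep (fun th => f th + g th) = Ep f + Ep g.
Proof.
move=> tf tg'; rewrite /Epost -RintegralD//; try exact: integrable_tame.
by congr Rintegral; apply/funext => t; rewrite mulrDl.
Qed.

Lemma EpostZ c (f : param -> R) : tame 2 f -> Ep (fun th => c * f th) = c * Ep f.
Proof.
move=> tf; rewrite /Epost -RintegralZl//; last exact: integrable_tame.
by congr Rintegral; apply/funext => t; rewrite mulrA.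
Qed.

Lemma EpostN (f : param -> R) : tame 2 f -> Ep (fun th => - f th) = - Ep f.
Proof.
move=> tf; rewrite -mulN1r -EpostZ//; congr Epost.
by apply/funext => th; rewrite mulN1r.
Qed.

Lemma Epost_ge0 (f : param -> R) : (forall th, 0 <= f th) -> 0 <= Ep f.
Proof.
by move=> f0; apply: Rintegral_ge0 => t _; rewrite mulr_ge0// posterior_ge0.
Qed.

Definition EpostC (F : param -> C) : C :=
  Ep (fun th => complex.Re (F th)) +i* Ep (fun th => complex.Im (F th)).

Lemma EpostCD F G : tame2C F -> tame2C G ->
  EpostC (fun th => F th + G th) = EpostC F + EpostC G.
Proof.
move=> [f1 f2] [g1 g2]; apply/eqP; rewrite eq_complex /=.
rewrite -EpostD// -EpostD//; apply/andP; split; apply/eqP; congr Epost;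
  by apply/funext => th; case: (F th) (G th) => [? ?] [? ?].
Qed.

Lemma EpostCZ c F : tame2C F -> EpostC (fun th => c * F th) = c * EpostC F.
Proof.
have tZ (a : R) (f : param -> R) : tame 2 f -> tame 2 (fun th => a * f th).
  by move=> tf; exact: (tameM (tame_cst 0 a) tf).
move=> [f1 f2]; case: c => a b; apply/eqP; rewrite eq_complex /=.
rewrite -(EpostZ a f1) -(EpostZ b f2) -(EpostZ a f2) -(EpostZ b f1).
rewrite -(EpostN (tZ b _ f2)) -(EpostD (tZ a _ f1) (tameN (tZ b _ f2))).
rewrite -(EpostD (tZ a _ f2) (tZ b _ f1)).
by apply/andP; split; apply/eqP; congr Epost; apply/funext => th; case: (F th).
Qed.

Lemma EpostC_sum I (r : seq I) (F : I -> param -> C) :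
  (forall i, tame2C (F i)) ->
  EpostC (fun th => \sum_(i <- r) F i th) = \sum_(i <- r) EpostC (F i).
Proof.
move=> tF; elim: r => [|i r IH].
  rewrite big_nil; under [X in EpostC X]eq_fun do rewrite big_nil.
  by have := EpostCZ 0 (gradedC_cst tg 2 0); rewrite !mul0r.
rewrite big_cons -IH -EpostCD//; last exact: (gradedC_sum tg).
by congr EpostC; apply/funext => th; rewrite big_cons.
Qed.

Lemma EpostC_conj F : tame2C F ->
  EpostC (fun th => Num.conj (F th)) = Num.conj (EpostC F).
Proof.
move=> [f1 f2]; apply/eqP; rewrite eq_complex /= -EpostN//.
by apply/andP; split; apply/eqP; congr Epost; apply/funext => th; case: (F th).
Qed.

Lemma EpostC_ge0 F : (forall th, 0 <= F th) -> 0 <= EpostC F.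
Proof.
move=> F0; rewrite lecE /=; apply/andP; split; last first.
  by apply: Epost_ge0 => th; have := F0 th; rewrite lecE => /andP[].
(* Nonnegativity in the complex order includes a zero imaginary part; writing it as [0 * 0] lets
   homogeneity give expectation zero. *)
rewrite (_ : (fun th => complex.Im (F th)) = fun=> 0 * 0).
  by rewrite EpostZ ?mul0r//; exact: tame_cst.
by apply/funext => th; rewrite mul0r (ger0_Im (F0 th)).
Qed.

Lemma EpostME m n (G : param -> 'M[C]_(m, n)) a b :
  EpM G a b = EpostC (fun th => G th a b).
Proof. by rewrite mxE. Qed.

Lemma EpostM_mull m n p (A : 'M[C]_(m, n)) (G : param -> 'M[C]_(n, p)) :
  tame2 G -> EpM (fun th => A *m G th) = A *m EpM G.
Proof.
move=> tG; apply/matrixP => a b; rewrite EpostME.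
under [X in EpostC X]eq_fun do rewrite mxE.
rewrite EpostC_sum => [|c]; last exact: (gradedCM tg (gradedC_cst tg 0 _)).
by rewrite mxE; apply: eq_bigr => c _; rewrite EpostME EpostCZ.
Qed.

Lemma EpostM_adj m n (G : param -> 'M[C]_(m, n)) :
  tame2 G -> (EpM G)^t* = EpM (fun th => (G th)^t* ).
Proof.
move=> tG; apply/matrixP => a b; rewrite EpostME mxE mxE EpostME -EpostC_conj//.
by congr EpostC; apply/funext => th; rewrite !mxE.
Qed.

Lemma EpostM_mulr m n p (A : 'M[C]_(n, p)) (G : param -> 'M[C]_(m, n)) :
  tame2 G -> EpM (fun th => G th *m A) = EpM G *m A.
Proof.
move=> tG; apply/matrixP => a b; rewrite EpostME.
under [X in EpostC X]eq_fun do rewrite mxE.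
rewrite EpostC_sum => [|c].
  rewrite mxE; apply: eq_bigr => c _; rewrite EpostME mulrC -EpostCZ//.
  by congr EpostC; apply/funext => th; rewrite mulrC.
rewrite -[2%N]/(2 + 0)%N; exact: (gradedCM tg _ (gradedC_cst tg 0 _)).
Qed.

Lemma EpostM_sum m n I (r : seq I) (G : I -> param -> 'M[C]_(m, n)) :
  (forall i, tame2 (G i)) ->
  EpM (fun th => \sum_(i <- r) G i th) = \sum_(i <- r) EpM (G i).
Proof.
move=> tG; apply/matrixP => a b; rewrite EpostME summxE.
under [X in EpostC X]eq_fun do rewrite summxE.
rewrite EpostC_sum => [|i]; last exact: tG.
by apply: eq_bigr => i _; rewrite EpostME.
Qed.

Lemma EpostM_scale m n c (G : param -> 'M[C]_(m, n)) :
  tame2 G -> EpM (fun th => c *: G th) = c *: EpM G.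
Proof.
move=> tG; apply/matrixP => a b; rewrite EpostME mxE EpostME -EpostCZ//.
by congr EpostC; apply/funext => th; rewrite mxE.
Qed.

(** Linearity moves [x] inside, where the quadratic form becomes the squared norm of the row
    [x^t* *m G th]. *)
Lemma EpostM_psd m n (G : param -> 'M[C]_(m, n)) :
  tame2 (fun th => G th *m (G th)^t* ) -> psdmxC (EpM (fun th => G th *m (G th)^t* )).
Proof.
move=> tG; split.
  rewrite EpostM_adj//; congr EpostM; apply/funext => th.
  by rewrite adjmx_mul trmxCK.
move=> x; rewrite -EpostM_mull// -EpostM_mulr.
  rewrite EpostME; apply: EpostC_ge0 => th.
  rewrite (_ : _ *m x = (x^t* *m G th) *m (x^t* *m G th)^t* ).
    exact: mulmx_adj_ge0.
  by rewrite adjmx_mul trmxCK !mulmxA.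
exact: (graded_mxM tg (graded_mx_cst tg 0 _) tG).
Qed.

Variable V : 'M[C]_(NT, MT).

Definition corr_mx (i j : 'I_(pdim L)) (th : param) : 'M[C]_NR :=
  dresponse i th *m (V *m V^t* ) *m (dresponse j th)^t*.

Definition mean_corr (i j : 'I_(pdim L)) : 'M[C]_NR := EpM (corr_mx i j).

Lemma corr_mxE i j th :
  corr_mx i j th = (dresponse i th *m V) *m (dresponse j th *m V)^t*.
Proof. by rewrite /corr_mx adjmx_mul !mulmxA. Qed.

Lemma tame_corr_mx i j : tame2 (corr_mx i j).
Proof.
rewrite -[2%N]/((1 + 0) + 1)%N; apply: (graded_mxM tg).
  by apply: (graded_mxM tg); [exact: dresponse_graded|exact: (graded_mx_cst tg)].
by apply: (graded_mx_adj tg); exact: dresponse_graded.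
Qed.

Lemma J_D_mean_corr RW :
  J_D fphi Vpol Wpol Y (V *m V^t* ) RW = mxinfo mean_corr RW.
Proof.
apply/matrixP => i j; rewrite !mxE; congr (2 * complex.Re (\tr _)).
rewrite -EpostM_mull; last exact: tame_corr_mx.
by congr EpostM; apply/funext => th; rewrite /corr_mx !mulmxA.
Qed.

Lemma mean_corr_herm i j : (mean_corr i j)^t* = mean_corr j i.
Proof.
rewrite EpostM_adj; last exact: tame_corr_mx.
congr EpostM; apply/funext => th.
by rewrite !corr_mxE [LHS]adjmx_mul trmxCK.
Qed.

Lemma mxcomb_mean_corr X : mxcomb mean_corr X =
  EpM (fun th => \sum_i \sum_j (X i j)%:C *: corr_mx i j th).
Proof.
have tZ i j : tame2 (fun th => (X i j)%:C *: corr_mx i j th).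
  under [Z in graded_mx _ _ Z]eq_fun do rewrite -mul_scalar_mx.
  exact: (graded_mxM tg (graded_mx_cst tg 0 _) (tame_corr_mx i j)).
rewrite EpostM_sum => [|i].
  apply: eq_bigr => i _; rewrite EpostM_sum//; apply: eq_bigr => j _.
  by rewrite EpostM_scale//; exact: tame_corr_mx.
move=> a b; under [Z in gradedC _ _ Z]eq_fun do rewrite summxE.
by apply: (gradedC_sum tg) => j; exact: tZ.
Qed.

Lemma Gdot_entry m (th : param) a i :
  Gdot (col m V) th a i = (dresponse i th *m V : 'M[C]_(NR, MT)) a m.
Proof. by rewrite !mxE; apply: eq_bigr => c _; rewrite !mxE. Qed.

(** Column [m] of [dresponse i th *m V] is column [i] of the matrix [Gdot] of beam [m], so
    [sum_sandwich_mx] applies pointwise under the expectation. *)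
Lemma Pmx_mean_corr X : Pmx fphi Vpol Wpol Y V X = mxcomb mean_corr X.
Proof.
rewrite mxcomb_mean_corr /Pmx -EpostM_sum => [|m].
  congr EpostM; apply/funext => th.
  apply: etrans (sum_sandwich_mx (A := fun i => dresponse i th *m V) _
    (fun m => Gdot_entry m th)) _.
  apply: eq_bigr => i _; apply: eq_bigr => j _.
  by rewrite -corr_mxE mxE.
have tG : graded_mx (@tame R L) 1 (fun th => Gdot (col m V) th : 'M[C]_(NR, pdim L)).
  move=> a i; under [Z in gradedC _ _ Z]eq_fun do rewrite Gdot_entry.
  exact: (graded_mxM tg (dresponse_graded i) (graded_mx_cst tg 0 V)).
rewrite -[2%N]/((1 + 0) + 1)%N; apply: (graded_mxM tg).
  by apply: (graded_mxM tg) => //; exact: (graded_mx_cst tg).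
exact: (graded_mx_adj tg).
Qed.

Lemma mean_corr_psd (x : 'cV[R]_(pdim L)) : psdmxC (mxcomb mean_corr (x *m x^T)).
Proof.
(* For [X = x *m x^T] the double sum of correlations factors as [Z] times its adjoint. *)
pose Z (th : param) : 'M[C]_(NR, MT) := \sum_i (x i 0)%:C *: (dresponse i th *m V).
have tZ : graded_mx (@tame R L) 1 Z.
  move=> a b; under [G in gradedC _ _ G]eq_fun do rewrite summxE.
  apply: (gradedC_sum tg) => i.
  under [G in gradedC _ _ G]eq_fun do rewrite mxE.
  apply: (gradedCM tg (gradedC_cst tg 0 _)).
  exact: (graded_mxM tg (dresponse_graded i) (graded_mx_cst tg 0 V)).
have -> : mxcomb mean_corr (x *m x^T) = EpM (fun th => Z th *m (Z th)^t* ).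
  rewrite mxcomb_mean_corr; congr EpostM; apply/funext => th.
  rewrite /Z mulmx_suml; apply: eq_bigr => i _.
  rewrite [(\sum_i0 _)^T]raddf_sum [map_mx _ _]raddf_sum/= mulmx_sumr.
  apply: eq_bigr => j _.
  rewrite adjmxZ -scalemxAl -scalemxAr scalerA corr_mxE mxE big_ord1 !mxE.
  congr (_ *: _); rewrite rmorphM; congr (_ * _); apply/esym; exact: conjc_real.
apply: EpostM_psd; rewrite -[2%N]/(1 + 1)%N; apply: (graded_mxM tg tZ).
exact: (graded_mx_adj tg).
Qed.

End PosteriorExpectation.

(** * Tightness of the relaxation *)

Theorem corollary2 (R : realType) (L NT NR MT MR k : nat)
  (L_ge1 : (1 <= L)%N)
  (MT_range : (1 <= MT < NT)%N) (MR_range : (1 <= MR < NR)%N)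
  (k_ge1 : (1 <= k)%N)
  (P : R) (P_gt0 : 0 < P)
  (* weights *)
  (q : 'I_(pdim L) -> R)
  (q_ge0 : forall l, 0 <= q l) (q_sum : \sum_l q l = 1)
  (* prior of the angles: any joint density with uniform marginals *)
  (phimin phimax : R) (phi_lt : phimin < phimax)
  (fphi : L.-tuple (measurableTypeR R) -> R)
  (fphi_meas : measurable_fun setT fphi)
  (fphi_ge0 : forall t, 0 <= fphi t)
  (fphi_marginal : forall (i : 'I_L) (B : set (measurableTypeR R)),
     measurable B ->
     (\int[lebesgue_tuple R L]_(t in [set t | B (tnth t i)]) (fphi t)%:E
      = uniform_prob phi_lt B)%E)
  (* past data and past beamformers *)
  (Vpol : seq 'M[R[i]]_(MR, MT) -> 'M[R[i]]_(NT, MT))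
  (Wpol : seq 'M[R[i]]_(MR, MT) -> 'M[R[i]]_(NR, MR))
  (Y : k.-1.-tuple 'M[R[i]]_(MR, MT))
  (W_rank : forall l : 'I_k.-1, \rank (Wpol (take l Y)) = MR)
  (J_P_psd : psdmxR (J_P fphi Vpol Wpol Y))
  (* current transmit beamformer *)
  (V : 'M[R[i]]_(NT, MT)) (V_power : \tr (V *m V^t* ) <= P%:C)
  (* identifiability *)
  (identifiable : exists RW : 'M[R[i]]_NR,
     relaxed_constraint MR RW /\
     bfim fphi Vpol Wpol Y (V *m V^t* ) RW \in unitmx)
  (* maximizer of the dual problem, with an eigenvalue gap *)
  (Lam : 'M[R]_(pdim L))
  (Lam_max : forall Lam' : 'M[R]_(pdim L),
     dual_objective fphi Vpol Wpol Y V q Lam'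
     <= dual_objective fphi Vpol Wpol Y V q Lam)
  (gap : eigval (Pmx fphi Vpol Wpol Y V (Lam *m Lam^T)) MR.+1
         < eigval (Pmx fphi Vpol Wpol Y V (Lam *m Lam^T)) MR) :
  optimal_value fphi Vpol Wpol Y (relaxed_constraint MR) V q =
  optimal_value fphi Vpol Wpol Y (projection_constraint MR) V q.
Proof.
(* The marginal of the first angle, evaluated on the whole line, shows that [fphi] has total mass
   1. *)
have fphi_int : (\int[lebesgue_tuple R L]_t (fphi t)%:E < +oo)%E.
  have := fphi_marginal (Ordinal L_ge1) setT measurableT.
  by rewrite probability_setT => ->; exact: ltry.
pose K := mean_corr fphi Vpol Wpol Y V.
pose JP := J_P fphi Vpol Wpol Y.
pose s := \row_l Num.sqrt (q l) : 'rV[R]_(pdim L).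
have bfimE RW : bfim fphi Vpol Wpol Y (V *m V^t* ) RW = mxinfo K RW + JP.
  by rewrite /bfim J_D_mean_corr.
have PE X : Pmx fphi Vpol Wpol Y V X = mxcomb K X by exact: Pmx_mean_corr.
have dualE L' : dual_objective fphi Vpol Wpol Y V q L' = dual_value K MR JP s L'.
  by rewrite /dual_objective /dual_value PE.
have r_range : (0 < MR < NR)%N by [].
have K_herm i j : (K i j)^t* = K j i by exact: mean_corr_herm.
have K_psd (x : 'cV[R]_(pdim L)) : psdmxC (mxcomb K (x *m x^T)) by exact: mean_corr_psd.
have mx L' : dual_value K MR JP s L' <= dual_value K MR JP s Lam.
  by rewrite -!dualE.
have gapK : eigval (mxcomb K (Lam *m Lam^T)) MR.+1 <
    eigval (mxcomb K (Lam *m Lam^T)) MR by rewrite -PE.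
have [W [cW JLam psdJ optW]] :=
  dual_certificate K_herm K_psd r_range J_P_psd mx gapK.
set J := mxinfo K W + JP in JLam psdJ optW.
(* Read column by column, stationarity says that the border of the [l]-th inequality is [J] times
   the [l]-th column of [Lam], the form required by [psd_block]. *)
have colE l : J *m col l Lam = Num.sqrt (q l) *: col l 1%:M.
  transitivity (col l (J *m Lam)); first by rewrite !colE mulmxA.
  by rewrite JLam; apply/colP => i; rewrite !mxE mulr_natr eq_sym; case: eqP => // ->.
pose v := \tr (Lam^T *m J *m Lam).
apply/eqP; rewrite eq_le; apply/andP; split.
  apply: le_ereal_inf => _ [rd [crd lrd] <-]; exists rd => //.
  by split => //; exact: projection_relaxed.
(* The value [v] separates the two optima: it is reached by the projection [W], and no relaxed point
   goes below it. *)
apply: (@le_trans _ _ v%:E).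
  apply: ereal_inf_lbound.
  exists (W, fun l => ((col l Lam)^T *m J *m col l Lam) 0 0) => /=.
    split; first exact: cW.
    move=> l; rewrite /= bfimE -/J -colE; exact: psd_block.
  by rewrite /v mxtrace_quad.
apply: le_ereal_inf_tmp => _ [[RW d] /= [cRW lRW] <-]; rewrite lee_fin.
have dl l : 2 * ((col l Lam)^T *m J *m col l Lam) 0 0 -
    ((col l Lam)^T *m (mxinfo K RW + JP) *m col l Lam) 0 0 <= d l.
  by rewrite -mulmxA colE -bfimE; exact: psd_block_lb (lRW l).
apply: le_trans (ler_sum _ (fun l _ => dl l)).
(* The summed lower bounds equal [2 * v] minus the trace of the quadratic form at [RW]; by [optW]
   that trace is at most [v]. *)
have le_twiceB (a b : R) : b <= a -> a <= 2 * a - b.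
  by move=> ba; rewrite mulr_natl mulr2n -addrA lerDl subr_ge0.
rewrite sumrB -mulr_sumr -(mxtrace_quad J Lam) -(mxtrace_quad _ Lam).
exact: le_twiceB (optW _ cRW).
Qed.
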